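(* Let $p>1$, let $f$ be locally Lipschitz continuous on $\mathbb{R}$ with $f(0)=0$ and $f>0$ on $(0,+\infty)$, and put $F(u)=\int_0^u f(s)\,ds$. Suppose that $f$ satisfies, for some constants $\alpha>2$, $\gamma>0$ and $\beta$ with $0\le\beta\le\frac{(\alpha-p)\lambda_{p,0}}{p}$, $$\alpha F(u)\le u f(u)+\beta u^{p}+\gamma\qquad\text{for all } u>0 .$$ Let $u_0:\overline S\to[0,+\infty)$ be a nontrivial function with $B[u_0]=0$ on $\partial S$ satisfying $$-\frac{1}{2p}\sum_{x,y\in\overline S}|u_0(x)-u_0(y)|^{p}\,\omega(x,y)-\frac1p\sum_{z\in\Gamma}\frac{\sigma(z)}{\mu(z)}|u_0(z)|^{p}+\sum_{x\in S}\left[F(u_0(x))-\gamma\right]>0 .$$ Then every solution $u$ (on its maximal interval of existence) of $$\begin{cases}u_t(x,t)=\Delta_{p,\omega}u(x,t)+f(u(x,t)), & x\in S,\ t>0,\\ B[u]=0, & \text{on }\partial S,\ t\ge 0,\\ u(x,0)=u_0(x), & x\in\overline S,\end{cases}$$ blows up at a finite time $T^*\in(0,+\infty)$, in the sense that $$\lim_{t\to T^{*}}\sum_{x\in S}u^{2}(x,t)=+\infty .$$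
   Context: Network: $G=(V,E)$ is a finite simple graph and $S$ is a connected induced subgraph of $G$. The vertex boundary is $\partial S=\{z\in V\setminus S: z\sim y\text{ for some }y\in S\}$, and $\overline S$ denotes the induced subgraph with vertex set $S\cup\partial S$. A weight $\omega:V\times V\to[0,+\infty)$ is given: symmetric, $\omega(x,x)=0$, and $\omega(x,y)>0$ if and only if $\{x,y\}\in E$. For $p>1$ and $u:\overline S\to\mathbb{R}$, $$\Delta_{p,\omega}u(x)=\sum_{y\in\overline S}|u(y)-u(x)|^{p-2}[u(y)-u(x)]\,\omega(x,y)\quad (x\in S),$$ $$\frac{\partial u}{\partial_p n}(z)=\sum_{x\in S}|u(z)-u(x)|^{p-2}[u(z)-u(x)]\,\omega(x,z)\quad (z\in\partial S),$$ with the convention $|0|^{p-2}0=0$. For functions $u(x,t)$ these are applied for each fixed $t$. Boundary operator: $\mu,\sigma:\partial S\to[0,+\infty)$ are given functions with $\mu(z)+\sigma(z)>0$ for all $z\in\partial S$, and $$B[u](z)=\mu(z)\frac{\partial u}{\partial_p n}(z)+\sigma(z)|u(z)|^{p-2}u(z),\quad z\in\partial S .$$ $\Gamma=\{z\in\partial S:\mu(z)>0\}$; a sum over $\Gamma=\emptyset$ is $0$. First eigenvalue: $\lambda_{p,0}$ is the first eigenvalue of $\Delta_{p,\omega}$ on $\overline S$ with boundary condition $B[\cdot]=0$, i.e. the (nonnegative) number for which there is a function $\phi_0$ on $\overline S$ with $\phi_0>0$ on $S\cup\Gamma$, $-\Delta_{p,\omega}\phi_0(x)=\lambda_{p,0}|\phi_0(x)|^{p-2}\phi_0(x)$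 for $x\in S$, and $B[\phi_0]=0$ on $\partial S$. (One has $\lambda_{p,0}=0$ if $\sigma\equiv0$ and $\lambda_{p,0}>0$ if $\sigma\not\equiv0$.) Solution: a function $u$ such that for each $x\in\overline S$, $u(x,\cdot)$ is continuous on $[0,T)$ and differentiable on $(0,T)$, where $[0,T)$ is the interval of existence, and $u$ satisfies the equation, boundary condition and initial condition there. *)

(* Defs.v *)
From mathcomp Require Import all_boot all_order all_algebra.
From mathcomp Require Import all_classical all_reals all_analysis.

Set Implicit Arguments.
Unset Strict Implicit.
Unset Printing Implicit Defensive.

Import Order.TTheory GRing.Theory Num.Theory.
Import numFieldNormedType.Exports.

Local Open Scope classical_set_scope.
Local Open Scope ring_scope.

(* A finite simple graph is a symmetric irreflexive relation E on a finType V.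
   Functions on the closure of S are total functions on V; every definition
   below only reads their values on [vclosure E S]. *)

Definition connected_in (V : finType) (E : rel V) (S : {set V}) : Prop :=
  S != finset.set0 /\
  {in S &, forall x y,
     connect [rel a b | [&& a \in S, b \in S & E a b]] x y}.

Definition vboundary (V : finType) (E : rel V) (S : {set V}) : {set V} :=
  [set z | (z \notin S) && [exists y in S, E z y]]%SET.

Definition vclosure (V : finType) (E : rel V) (S : {set V}) : {set V} :=
  S :|: vboundary E S.

Record is_weight (R : realType) (V : finType) (E : rel V) (w : V -> V -> R)
    : Prop := IsWeight {
  weight_ge0 : forall x y, 0 <= w x y;
  weight_sym : forall x y, w x y = w y x;
  weight_diag : forall x, w x x = 0;
  weight_edge : forall x y, 0 < w x y <-> E x y
}.

(* |a|^{p-2} a; the factor a makes it 0 at a = 0, also when p <= 2. *)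
Definition ppow (R : realType) (p a : R) : R := `|a| `^ (p - 2) * a.

Definition pLaplacian (R : realType) (V : finType) (E : rel V) (S : {set V})
    (w : V -> V -> R) (p : R) (u : V -> R) (x : V) : R :=
  \sum_(y in vclosure E S) ppow p (u y - u x) * w x y.

Definition pnormal (R : realType) (V : finType) (S : {set V})
    (w : V -> V -> R) (p : R) (u : V -> R) (z : V) : R :=
  \sum_(x in S) ppow p (u z - u x) * w x z.

Definition boundary_op (R : realType) (V : finType) (S : {set V})
    (w : V -> V -> R) (p : R) (mu sigma : V -> R) (u : V -> R) (z : V) : R :=
  mu z * pnormal S w p u z + sigma z * ppow p (u z).

Definition Gamma_set (R : realType) (V : finType) (E : rel V) (S : {set V})
    (mu : V -> R) : {set V} :=
  [set z in vboundary E S | 0 < mu z]%SET.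

(* [lambda] is the first eigenvalue: the number having an eigenfunction that
   is positive on S and Gamma. *)
Definition is_first_eigenvalue (R : realType) (V : finType) (E : rel V)
    (S : {set V}) (w : V -> V -> R) (p : R) (mu sigma : V -> R) (lambda : R)
    : Prop :=
  0 <= lambda /\
  exists phi : V -> R,
    [/\ forall x, x \in S :|: Gamma_set E S mu -> 0 < phi x,
        forall x, x \in S ->
          - pLaplacian E S w p phi x = lambda * ppow p (phi x)
      & forall z, z \in vboundary E S ->
          boundary_op S w p mu sigma phi z = 0].

(* The oriented integral of f from 0 to u. *)
Definition primitive0 (R : realType) (f : R -> R) (u : R) : R :=
  if 0 <= u then \int[lebesgue_measure]_(s in `[0, u]) f s
  else - \int[lebesgue_measure]_(s in `[u, 0]) f s.

(* [u] solves the problem on [0, T), where T may be +oo. *)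
Record is_solution (R : realType) (V : finType) (E : rel V) (S : {set V})
    (w : V -> V -> R) (p : R) (mu sigma : V -> R) (f : R -> R) (u0 : V -> R)
    (T : \bar R) (u : V -> R -> R) : Prop := IsSolution {
  sol_time_gt0 : (0 < T)%E;
  sol_continuous : forall x, x \in vclosure E S ->
    {within [set t : R | 0 <= t /\ (t%:E < T)%E], continuous (u x)};
  sol_derivable : forall x (t : R), x \in vclosure E S -> 0 < t -> (t%:E < T)%E ->
    derivable (u x) t 1;
  sol_equation : forall x (t : R), x \in S -> 0 < t -> (t%:E < T)%E ->
    derive1 (u x) t = pLaplacian E S w p (u^~ t) x + f (u x t);
  sol_boundary : forall z (t : R), z \in vboundary E S -> 0 <= t -> (t%:E < T)%E ->
    boundary_op S w p mu sigma (u^~ t) z = 0;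
  sol_initial : forall x, x \in vclosure E S -> u x 0 = u0 x
}.

Definition is_maximal_solution (R : realType) (V : finType) (E : rel V)
    (S : {set V}) (w : V -> V -> R) (p : R) (mu sigma : V -> R) (f : R -> R)
    (u0 : V -> R) (T : \bar R) (u : V -> R -> R) : Prop :=
  is_solution E S w p mu sigma f u0 T u /\
  forall (T' : \bar R) (v : V -> R -> R), (T < T')%E ->
    is_solution E S w p mu sigma f u0 T' v ->
    ~ (forall x (t : R), x \in vclosure E S -> 0 <= t -> (t%:E < T)%E ->
         v x t = u x t).

(* Main.v *)
Require Import Defs.
From mathcomp Require Import all_boot all_order all_algebra.
From mathcomp Require Import all_classical all_reals all_analysis.
From mathcomp Require Import ring lra.

Set Implicit Arguments.
Unset Strict Implicit.
Unset Printing Implicit Defensive.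

Import Order.TTheory GRing.Theory Num.Theory.
Import numFieldNormedType.Exports.

Local Open Scope classical_set_scope.
Local Open Scope ring_scope.

(** The proof runs on an energy.  Summation by parts over the edges that meet
    [S] turns the boundary condition into a weak formulation: tested against
    [psi], minus the p-Laplacian of a solution [u] is a form [A(u, psi)] that
    collects the edge differences and, on [Gamma], the term [sigma / mu]
    ([weak_formulation]).  Hence the energy
    [En = sum_S (F(u) - gamma) - A(u, u) / p] has [En' = sum_S u_t ^ 2], while
    [J = sum_S u ^ 2] satisfies [J' / 2 = - A(u, u) + sum_S u f(u)].  Edges
    inside the boundary do not enter [A]; they only lower the initial energy, so
    the hypothesis on [u0] still gives [0 < En 0] ([energy0_gt0]).

    Suppose [p <= alpha].  Picone's inequality, applied with the positive first
    eigenfunction, gives [lambda sum_S |u| ^ p <= A(u, u)] ([eigenvalue_le]).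
    With the growth condition on [f] and the bound on [beta] this yields
    [2 alpha En <= J'], where the growth condition may be used because solutions
    stay nonnegative ([sol_ge0]).  Since [J' ^ 2 <= 4 J En'] by Cauchy-Schwarz,
    [En J ^ (- alpha / 2)] is nondecreasing ([levine_concavity]), hence
    [c J ^ (alpha / 2) <= J'] for some positive [c].  Suppose [alpha < p].  The
    bounds on [beta] then force [lambda = beta = 0], and an eigenvalue zero means
    that the boundary condition is the Neumann one ([eigenvalue0_neumann]).  So
    [m = sum_S u] satisfies [m' = sum_S f(u)], and the growth condition makes
    [f(s)] at least a multiple of [s ^ (alpha - 1)] ([power_growth]).  In both
    cases some functional [Y] of the solution satisfies [c Y ^ (1 + e) <= Y'],
    and such an inequality cannot hold beyond a finite time
    ([growth_functional], [superlinear_finite_time]).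

    It remains to see that [Y] is unbounded at the end [T] of a maximal
    solution, that is, that a bounded solution can be continued
    ([continuation]).  The boundary values are determined by the values on [S]:
    the boundary condition at [z] says that [u z] is a generalized mean of its
    neighbours' values, the root of a strictly increasing function.  This mean
    is 1-Lipschitz, so the system is an ordinary differential equation on [S]
    with a continuous right-hand side.  For [p < 2] that right-hand side is in
    general not Lipschitz, and continuation uses Peano's theorem ([peano]), obtained as an
    ultrafilter limit of Euler polygons.  A solution must also be
    differentiable on the boundary.  The mean is in general not differentiable as
    a function of several variables, but it is so along every differentiable
    curve, because it is odd and homogeneous at the points where it degenerates
    ([derivable_pbalance]). *)

(** * The odd power and Picone's inequality *)

Section PPow.
Context {R : realType}.
Implicit Types p a b x y : R.

Lemma ppow0 p : ppow p 0 = 0.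
Proof. by rewrite /ppow mulr0. Qed.

Lemma ppowN p a : ppow p (- a) = - ppow p a.
Proof. by rewrite /ppow normrN mulrN. Qed.

Lemma ppowM p a b : ppow p (a * b) = ppow p a * ppow p b.
Proof. by rewrite /ppow normrM powRM// mulrACA. Qed.

Lemma ppow_powR p a : 1 < p -> 0 <= a -> ppow p a = a `^ (p - 1).
Proof.
move=> p1; rewrite le_eqVlt => /predU1P[<-|a0].
  by rewrite ppow0 powR0// subr_eq0 gt_eqF.
rewrite /ppow gtr0_norm// -{2}(powRr1 (ltW a0)) -powRD.
  by congr (_ `^ _); ring.
by rewrite (gt_eqF a0) implybT.
Qed.

Lemma ppow_mul p a : 1 < p -> ppow p a * a = `|a| `^ p.
Proof.
move=> p1.
have p0 : 0 < p by apply: lt_trans p1.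
have pos x : 0 <= x -> ppow p x * x = `|x| `^ p.
  by move=> x0; rewrite ppow_powR// mulrC mulr_powRB1// ger0_norm.
have [/pos//|a0] := leP 0 a.
by rewrite -(opprK a) ppowN mulrNN normrN pos ?normrN// oppr_ge0 ltW.
Qed.

Lemma norm_ppow p a : 1 < p -> `|ppow p a| = `|a| `^ (p - 1).
Proof.
by move=> p1; rewrite -ppow_powR// /ppow normrM !normr_id ger0_norm ?powR_ge0.
Qed.

Lemma ltr_ppow p : 1 < p -> {mono ppow p : x y / x < y}.
Proof.
move=> p1; apply: leW_mono; apply: le_mono.
have pos a b : 0 <= a -> a < b -> ppow p a < ppow p b.
  move=> a0 ab; have b0 := ltW (le_lt_trans a0 ab).
  by rewrite !ppow_powR// gt0_ltr_powR// ?subr_gt0// nnegrE.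
move=> a b ab; have [a0|a0] := leP 0 a; first exact: pos.
have [b0|b0] := leP 0 b.
  apply: (@lt_le_trans _ _ 0); last by rewrite ppow_powR// powR_ge0.
  by rewrite -(opprK a) ppowN oppr_lt0 -{1}(ppow0 p) pos// oppr_gt0.
by rewrite -(opprK a) -(opprK b) 2!(ppowN _ (- _)) ltrN2 pos// ?oppr_ge0 ?ltrN2// ltW.
Qed.

Lemma ler_ppow p : 1 < p -> {mono ppow p : x y / x <= y}.
Proof. by move=> p1 x y; rewrite !leNgt ltr_ppow. Qed.

Lemma ppow_ge0 p a : 1 < p -> (0 <= ppow p a) = (0 <= a).
Proof. by move=> p1; rewrite -{1}(ppow0 p) ler_ppow. Qed.

Lemma ppow_gt0 p a : 1 < p -> (0 < ppow p a) = (0 < a).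
Proof. by move=> p1; rewrite -{1}(ppow0 p) ltr_ppow. Qed.

Lemma ppow_eq0 p a : 1 < p -> (ppow p a == 0) = (a == 0).
Proof. by move=> p1; rewrite !eq_le -{1 2}(ppow0 p) !ler_ppow//. Qed.

Lemma powR_cvg0_norm p : 0 < p -> `|x| `^ p @[x --> (0 : R)] --> (0 : R).
Proof.
move=> p0; apply/cvgr0Pnorm_lt => e e0.
exists (e `^ p^-1) => /=; first exact: powR_gt0.
move=> x /=; rewrite sub0r normrN => xe.
rewrite ger0_norm ?powR_ge0//.
have -> : e = (e `^ p^-1) `^ p.
  by rewrite -powRrM mulVf ?gt_eqF// powRr1// ltW.
by rewrite gt0_ltr_powR// nnegrE// powR_ge0.
Qed.

Lemma is_derive_ppow p b : 1 < p -> b != 0 ->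
  is_derive b 1 (ppow p) ((p - 1) * `|b| `^ (p - 2)).
Proof.
move=> p1; have pos x : 0 < x ->
    is_derive x 1 (ppow p) ((p - 1) * x `^ (p - 2)).
  move=> x0; have -> : p - 2 = p - 1 - 1 by ring.
  apply: near_eq_is_derive (is_derive1_powR (p - 1) x0).
  by near=> y; rewrite ppow_powR// ltW//; near: y; exact: lt_nbhsr.
rewrite neq_lt => /orP[b0|b0]; last by rewrite gtr0_norm//; exact: pos.
have Nb0 : 0 < - b by rewrite oppr_gt0.
have := pos _ Nb0; rewrite ltr0_norm// => d1.
have d2 : is_derive b (1 : R) (fun x : R => - x) (-1) by exact: is_deriveNid.
have d3 := @is_derive1_comp _ (ppow p) -%R b _ _ d1 d2.
have := is_deriveN d3.
rewrite mulrN1 opprK; apply: near_eq_is_derive.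
by near=> y; rewrite fctE /= ppowN opprK.
Unshelve. all: by end_near. Qed.

Lemma continuous_ppow p : 1 < p -> continuous (ppow p).
Proof.
move=> p1 a; have [->|a0] := eqVneq a 0; last first.
  by apply/differentiable_continuous/derivable1_diffP; case: (is_derive_ppow p1 a0).
rewrite /continuous_at ppow0; apply/norm_cvg0P.
under eq_cvg do rewrite norm_ppow//.
by apply: powR_cvg0_norm; rewrite subr_gt0.
Qed.


(** As [|y| ^ p = ppow p y * y], the difference quotient at [0] is [ppow p]
    itself, which tends to [0]; elsewhere the product rule applies. *)
Lemma is_derive_norm_powR p x : 1 < p ->
  is_derive x 1 (fun y => `|y| `^ p) (p * ppow p x).
Proof.
move=> p1.
have -> : (fun y => `|y| `^ p) = (fun y : R => ppow p y * y).
  by apply/funext => y; rewrite ppow_mul.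
have [->|x0] := eqVneq x 0.
  apply/is_derive1_caratheodory; exists (ppow p); split => //.
  - by move=> z; rewrite mulr0 !subr0.
  - exact: continuous_ppow.
  - by rewrite ppow0 mulr0.
have := is_deriveM (is_derive_ppow p1 x0) (is_derive_id x 1).
rewrite (_ : _ + _ = p * ppow p x) //.
by rewrite /ppow /GRing.scale /=; ring.
Qed.

Lemma powR_convex2 p l x y : 1 <= p -> 0 <= l <= 1 -> 0 <= x -> 0 <= y ->
  (l * x + (1 - l) * y) `^ p <= l * x `^ p + (1 - l) * y `^ p.
Proof.
move=> p1 /andP[l0 l1] x0 y0.
have := @convex_powR _ p p1 (Itv01 l0 l1) x y.
rewrite !inE /= !in_itv /= x0 y0 => /(_ isT isT).
by rewrite !convRE.
Qed.

(** Put [l = (c - d) / c].  Then [x <= |x - y| + y], and the right-hand side is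
    the convex combination, with weights [l] and [1 - l = d / c], of
    [|x - y| / l] and [y / (1 - l)]; convexity of the power and a multiplication
    by [ppow p (c - d) / ppow p c] give the inequality. *)
Lemma picone_le p x y c d : 1 < p -> 0 < c -> 0 < d -> 0 <= x -> 0 <= y ->
  ppow p (c - d) * (x `^ p / ppow p c - y `^ p / ppow p d) <= `|x - y| `^ p.
Proof.
move=> p1.
wlog dc : x y c d / d <= c => [H c0 d0 x0 y0|c0 d0 x0 y0].
  have [dc|cd] := leP d c; first exact: H.
  rewrite -[c - d]opprB ppowN mulNr -mulrN opprB distrC; apply: H => //.
  exact: ltW.
have [->|cd] := eqVneq c d; first by rewrite subrr ppow0 mul0r powR_ge0.
have {dc cd} e0 : 0 < c - d by rewrite subr_gt0 lt_neqAle eq_sym cd.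
set e := c - d in e0 *; set s := `|x - y|.
have s0 : 0 <= s by exact: normr_ge0.
have pc : 0 < ppow p c by rewrite ppow_gt0.
have pd : 0 < ppow p d by rewrite ppow_gt0.
have pe : 0 < ppow p e by rewrite ppow_gt0.
have p0 : 0 <= p by apply/ltW/(lt_trans _ p1).
have scal z k : 0 <= z -> 0 < k -> (c / k * z) `^ p = c * ppow p c / (k * ppow p k) * z `^ p.
  have pE t : 0 < t -> t * ppow p t = t `^ p.
    by move=> t0; rewrite mulrC ppow_mul// gtr0_norm.
  move=> z0 k0; rewrite !pE// powRM//; last by rewrite divr_ge0// ltW.
  by rewrite powRM ?ltW ?invr_gt0// -powR_inv1 ?ltW// -powRrM mulN1r powRN.
have := @powR_convex2 p (e / c) (c / e * s) (c / d * y) (ltW p1) _ _ _.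
have -> : 1 - e / c = d / c by rewrite /e; field; rewrite gt_eqF.
have -> : e / c * (c / e * s) + d / c * (c / d * y) = s + y.
  by field; rewrite !gt_eqF.
rewrite !scal// => /(_ _ _ _) cvx.
have {cvx} : (s + y) `^ p <= ppow p c / ppow p e * s `^ p + ppow p c / ppow p d * y `^ p.
  apply: le_trans (cvx _ _ _) _.
  - rewrite divr_ge0 ?(ltW e0) ?(ltW c0)//= ler_pdivrMr// mul1r /e; lra.
  - by rewrite mulr_ge0// divr_ge0 ?ltW.
  - by rewrite mulr_ge0// divr_ge0 ?ltW.
  by rewrite le_eqVlt; apply/orP; left; apply/eqP; field; rewrite !gt_eqF.
have xp : x `^ p <= (s + y) `^ p.
  apply: ge0_ler_powR => //; rewrite ?nnegrE ?addr_ge0//.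
  by rewrite -lerBlDr ler_norm.
move/(le_trans xp).
rewrite -(ler_pM2l (divr_gt0 pe pc)) => H.
rewrite mulrBr lerBlDr.
have -> : ppow p e * (x `^ p / ppow p c) = ppow p e / ppow p c * x `^ p by ring.
apply: le_trans H _.
by rewrite le_eqVlt; apply/orP; left; apply/eqP; field; rewrite !gt_eqF.
Qed.

Lemma picone p x y c d : 1 < p -> 0 < c -> 0 < d ->
  ppow p (c - d) * (`|x| `^ p / ppow p c - `|y| `^ p / ppow p d)
  <= `|x - y| `^ p.
Proof.
move=> p1 c0 d0; apply: le_trans (picone_le p1 c0 d0 _ _) _ => //.
by apply: ge0_ler_powR; rewrite ?nnegrE ?ler_dist_dist//; apply/ltW/(lt_trans _ p1).
Qed.

End PPow.

(** * Limits along ultrafilters *)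

Section Ultra.
Context {R : realType}.

Lemma ultra_bounded_cvg T (G : set_system T) (UG : UltraFilter G) (g : T -> R) M :
  (\forall x \near G, `|g x| <= M) -> exists l : R, g x @[x --> G] --> l.
Proof.
move=> gM.
have gI : (g @ G) `[- M, M]%classic.
  by apply: filterS gM => x; rewrite /= in_itv/= ler_norml.
have [l [_ lG]] := [elaborate @segment_compact R (- M) M (g @ G) _ gI].
exists l => U lU.
have [//|GU] := in_ultra_setVsetC (g @^-1` U) UG.
by have [y []] := lG (~` U) U GU lU.
Qed.

(** If the preimage of a neighbourhood were not in [F], some ultrafilter finer
    than [F] would contain its complement. *)
Lemma cvg_ultra T (F : set_system T) (FF : ProperFilter F) (g : T -> R) (l : R) :
  (forall G, UltraFilter G -> F `<=` G -> g x @[x --> G] --> l) ->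
  g x @[x --> F] --> l.
Proof.
move=> H U lU; apply: contrapT => nFU.
have PF : ProperFilter (within (~` (g @^-1` U)) F).
  apply: Build_ProperFilter_ex => P; rewrite /within /= => FP.
  apply: contrapT => nP; apply: nFU; apply: filterS FP => x /= Px.
  by apply: contrapT => nUx; apply: nP; exists x; apply: Px.
have [G [UG sG]] := ultraFilterLemma PF.
have FG : F `<=` G by move=> A FA; apply: sG; apply: (@cvg_within _ F FF).
have GU : G (g @^-1` U) := H G UG FG U lU.
have GnU : G (~` (g @^-1` U)) by apply: sG; apply: (@withinT _ F).
by have [x [/= ? ?]] := filter_ex (filterI GU GnU).
Qed.
End Ultra.

Lemma cvg_sumr (R : realType) (I : finType) (P : pred I) T (F : set_system T)
    (g : I -> T -> R) (l : I -> R) : Filter F ->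
  (forall i, P i -> g i x @[x --> F] --> l i) ->
  \sum_(i | P i) g i x @[x --> F] --> \sum_(i | P i) l i.
Proof.
move=> FF gl.
have -> : (fun x => \sum_(i | P i) g i x) = \sum_(i | P i) g i.
  by apply/funext => y; rewrite fct_sumE.
by elim/big_ind2 : _ => // [|f a h b fa hb]; [exact: cvg_cst|exact: cvgD].
Qed.

Lemma is_derive_sumr (R : realType) (I : finType) (P : pred I)
    (g : I -> R -> R) (dg : I -> R) (x : R) :
  (forall i, P i -> is_derive x 1 (g i) (dg i)) ->
  is_derive x 1 (fun y => \sum_(i | P i) g i y) (\sum_(i | P i) dg i).
Proof.
move=> H.
have -> : (fun y => \sum_(i | P i) g i y) = \sum_(i | P i) g i.
  by apply/funext => y; rewrite fct_sumE.
by elim/big_ind2 : _ => // *; [exact: is_derive_cst|exact: is_deriveD].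
Qed.

Lemma is_derive_mull (R : realType) (k : R) (g : R -> R) (dg t : R) :
  is_derive t (1 : R) g dg -> is_derive t (1 : R) (fun s => k * g s) (k * dg).
Proof. by move=> H; exact: is_deriveZ. Qed.

Lemma is_derive_mulr (R : realType) (k : R) (g : R -> R) (dg t : R) :
  is_derive t (1 : R) g dg -> is_derive t (1 : R) (fun s => g s * k) (dg * k).
Proof.
move=> H; rewrite mulrC; have -> : (fun s => g s * k) = (fun s => k * g s).
  by apply/funext => s; rewrite mulrC.
exact: is_derive_mull.
Qed.

(** * The p-mean *)

Section PMean.
Context {R : realType} {I : finType}.
Variables (p : R) (c : I -> R).
Hypotheses (p1 : 1 < p) (c_ge0 : forall i, 0 <= c i) (c_gt0 : exists i, 0 < c i).
Implicit Types (X : I -> R) (Z : R).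

(** The derivative in [Z] of [sum_i c i * |Z - X i| ^ p / p], which the weighted
    p-mean of the [X i] minimizes. *)
Definition pbalance X Z : R := \sum_i c i * ppow p (Z - X i).

Lemma pbalance_lt X Y Z Z' : (forall i, Z - X i < Z' - Y i) ->
  pbalance X Z < pbalance Y Z'.
Proof.
move=> H; have [j cj] := c_gt0.
rewrite /pbalance (bigD1 j)//= [ltRHS](bigD1 j)//=.
apply: ltr_leD; first by rewrite ltr_pM2l// ltr_ppow.
by apply: ler_sum => i _; rewrite ler_wpM2l// ler_ppow// ltW.
Qed.

Lemma pbalance_root X : exists Z, pbalance X Z = 0.
Proof.
pose M := \sum_i `|X i|.
have XM i : `|X i| <= M by rewrite /M (bigD1 i)//= lerDl sumr_ge0.
have M0 : 0 <= M by rewrite sumr_ge0.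
have cont : {within `[- M, M], continuous (pbalance X)}.
  apply: continuous_subspaceT => Z; apply: cvg_sumr => i _.
  apply: cvgM; first exact: cvg_cst.
  apply: (@continuous_comp _ _ _ (fun Z => Z - X i) (ppow p) Z).
    by apply: cvgB => //; exact: cvg_cst.
  exact: continuous_ppow.
have [||Z _ Z0] := IVT (v := 0) _ cont; last by exists Z.
- by rewrite (le_trans _ M0)// oppr_le0.
- rewrite ge_min le_max; apply/andP; split; apply/orP; [left|right].
    apply: sumr_le0 => i _; apply: mulr_ge0_le0 => //.
    rewrite -oppr_ge0 -ppowN ppow_ge0//.
    by have := XM i; rewrite ler_norml => /andP[]; lra.
  apply: sumr_ge0 => i _; apply: mulr_ge0 => //; rewrite ppow_ge0//.
  by have := XM i; rewrite ler_norml => /andP[]; lra.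
Qed.

(** Comparison: the balance is strictly increasing in [Z] and depends on the
    differences [Z - X i] only. *)
Lemma pbalance_le X Y Z Z' d : (forall i, X i <= Y i + d) ->
  pbalance X Z = 0 -> pbalance Y Z' = 0 -> Z <= Z' + d.
Proof.
move=> XY eZ eZ'; rewrite leNgt; apply/negP => lt.
suff : pbalance Y Z' < pbalance X Z by rewrite eZ eZ' ltxx.
by apply: pbalance_lt => i; have := XY i; lra.
Qed.

Lemma pbalance_dist X Y Z Z' d : (forall i, `|X i - Y i| <= d) ->
  pbalance X Z = 0 -> pbalance Y Z' = 0 -> `|Z - Z'| <= d.
Proof.
move=> XY eZ eZ'; rewrite ler_distl; apply/andP; split.
  suff : Z' <= Z + d by lra.
  apply: pbalance_le eZ' eZ => i; have := XY i.
  by rewrite distrC ler_distl => /andP[]; lra.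
apply: pbalance_le eZ eZ' => i; have := XY i.
by rewrite ler_distl => /andP[]; lra.
Qed.

Lemma pbalance_uniq X Z Z' : pbalance X Z = 0 -> pbalance X Z' = 0 -> Z = Z'.
Proof.
move=> eZ eZ'; apply/eqP; rewrite -subr_eq0 -normr_le0.
by apply: pbalance_dist eZ eZ' => i; rewrite subrr normr0.
Qed.

Definition pmean X : R := xget 0 [set Z | pbalance X Z = 0].

Lemma pmeanP X : pbalance X (pmean X) = 0.
Proof.
have [Z eZ] := pbalance_root X.
by apply: (@xgetPex _ 0 [set Z | pbalance X Z = 0]); exists Z.
Qed.

Lemma pmean_eq X Z : pbalance X Z = 0 -> pmean X = Z.
Proof. by apply: pbalance_uniq; exact: pmeanP. Qed.

Lemma pmean_dist X Y d : (forall i, `|X i - Y i| <= d) ->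
  `|pmean X - pmean Y| <= d.
Proof. by move=> XY; apply: pbalance_dist XY _ _; exact: pmeanP. Qed.

Lemma pmean_norm X M : (forall i, `|X i| <= M) -> `|pmean X| <= M.
Proof.
move=> XM; have -> : pmean X = pmean X - pmean (fun=> 0).
  rewrite [X in _ - X](@pmean_eq _ 0) ?subr0//.
  by rewrite /pbalance big1// => i _; rewrite subrr ppow0 mulr0.
by apply: pmean_dist => i; rewrite subr0.
Qed.

Lemma cvg_pmean T (F : set_system T) (FF : Filter F) (X : I -> T -> R) (a : I -> R) :
  (forall i, X i x @[x --> F] --> a i) ->
  pmean (X^~ x) @[x --> F] --> pmean a.
Proof.
move=> Xa; apply/cvgrPdist_le => e e0.
have : \forall x \near F, forall i, `|a i - X i x| <= e.
  apply: filter_forall => i; move/cvgrPdist_le : (Xa i); exact.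
by apply: filterS => x H; apply: pmean_dist.
Qed.

End PMean.

(** * Differentiability of the p-mean along curves *)

Section PMeanDerivable.
Context {R : realType} {I : finType}.
Variables (p : R) (c : I -> R).
Hypotheses (p1 : 1 < p) (c_ge0 : forall i, 0 <= c i) (c_gt0 : exists i, 0 < c i).

Lemma cvg_norm_powR_dnbhs0 (a : R) : 0 <= a ->
  exists2 L : R, 0 <= L & `|h| `^ a @[h --> (0 : R)^'] --> L.
Proof.
rewrite le_eqVlt => /predU1P[<-|a0].
  exists 1 => //; under eq_cvg do rewrite powRr0; exact: cvg_cst.
exists 0 => //; apply: cvg_trans (powR_cvg0_norm a0).
by apply: cvg_app; exact: cvg_within.
Qed.

Variables (X : I -> R -> R) (Z : R -> R) (t0 : R) (d : I -> R).
Hypothesis balance : forall t, pbalance p c (X^~ t) (Z t) = 0.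

Let q i h : R := h^-1 * (X i (h + t0) - X i t0).
Let D h : R := h^-1 * (Z (h + t0) - Z t0).
Hypothesis q_cvg : forall i, q i h @[h --> (0 : R)^'] --> d i.

Let b i := Z t0 - X i t0.
Let e i h := ppow p (Z (h + t0) - X i (h + t0)) - ppow p (b i).

Let eE i h : h != 0 -> e i h = ppow p (b i + h * (D h - q i h)) - ppow p (b i).
Proof. by move=> h0; rewrite /e /D /q /b; congr (ppow p _ - _); field. Qed.

Let D_bounded : \forall h \near (0 : R)^', `|D h| <= \sum_i `|d i| + 1.
Proof.
have : \forall h \near (0 : R)^', forall i, `|d i - q i h| <= 1.
  by apply: filter_forall => i; move/cvgrPdist_le : (@q_cvg i); exact.
move=> H; near=> h.
have h0 : h != 0 by near: h; exact: nbhs_dnbhs_neq.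
have hp : 0 < `|h| by rewrite normr_gt0.
rewrite /D normrM normfV mulrC ler_pdivrMr//.
apply: (pbalance_dist p1 c_ge0 c_gt0) (balance _) (balance _) => i.
have -> : X i (h + t0) - X i t0 = q i h * h by rewrite /q mulrC mulVKf.
rewrite normrM ler_pM2r//.
have := near H h _ => /(_ _ i) di.
have -> : q i h = d i - (d i - q i h) by ring.
apply: le_trans (ler_normB _ _) _; apply: lerD; last exact: di.
by rewrite (bigD1 i)//= lerDl sumr_ge0.
Unshelve. all: by end_near. Qed.

(** Along any ultrafilter the bounded quotient [D] has a limit [k].  Dividing
    the balance equation by the scale [s] shows that [k] is a zero of
    [sum_i c i * P i k], which is strictly increasing and independent of the
    ultrafilter; so all these limits coincide. *)
Let scaled_limit (s : R -> R) (P : I -> R -> R) :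
  (forall i k k', 0 < c i -> k <= k' -> P i k <= P i k') ->
  (exists2 i, 0 < c i & forall k k', k < k' -> P i k < P i k') ->
  (forall G k, UltraFilter G -> (0 : R)^' `<=` G -> D h @[h --> G] --> k ->
    forall i, 0 < c i -> e i h / s h @[h --> G] --> P i k) ->
  exists k : R, D h @[h --> (0 : R)^'] --> k.
Proof.
move=> Pmono [j cj Pj] elim_cvg.
have Glim G : UltraFilter G -> (0 : R)^' `<=` G ->
    exists2 k : R, D h @[h --> G] --> k & \sum_i c i * P i k = 0.
  move=> UG sG; have [|k Dk] := @ultra_bounded_cvg _ _ G UG D (\sum_i `|d i| + 1).
    exact: (sG _ D_bounded).
  exists k => //.
  have : \sum_i c i * (e i h / s h) @[h --> G] --> \sum_i c i * P i k.
    apply: cvg_sumr => i _; have := c_ge0 i; rewrite le_eqVlt => /predU1P[<-|ci].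
      by under eq_cvg do rewrite mul0r; rewrite mul0r; exact: cvg_cst.
    by apply: cvgM; [exact: cvg_cst|exact: elim_cvg].
  have -> : (fun h => \sum_i c i * (e i h / s h)) = (fun=> 0).
    apply/funext => h; under eq_bigr do rewrite mulrA.
    rewrite -mulr_suml; under eq_bigr do rewrite mulrBr.
    rewrite sumrB -!/(pbalance _ _ _ _).
    have := balance (h + t0); have := balance t0; rewrite /pbalance => -> ->.
    by rewrite subr0 mul0r.
  by move=> H; apply: (cvg_unique _ H); [exact: Rhausdorff|exact: cvg_cst].
have PF0 : ProperFilter (0 : R)^' by exact: Proper_dnbhs_numFieldType.
have [G0 [UG0 sG0]] := ultraFilterLemma PF0.
have [k0 _ k0E] := Glim G0 UG0 sG0.
exists k0; apply: cvg_ultra => G UG sG.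
have [k Dk kE] := Glim G UG sG.
have inj k1 k2 : k1 < k2 -> \sum_i c i * P i k1 < \sum_i c i * P i k2.
  move=> k12; rewrite (bigD1 j)//= [ltRHS](bigD1 j)//=; apply: ltr_leD.
    by rewrite ltr_pM2l//; exact: Pj.
  apply: ler_sum => i _; have := c_ge0 i; rewrite le_eqVlt => /predU1P[<-|ci].
    by rewrite !mul0r.
  by rewrite ler_pM2l//; apply: Pmono => //; exact: ltW.
suff -> : k0 = k by [].
by case: (ltgtP k0 k) => // /inj; rewrite kE k0E ltxx.
Qed.

Section limits.
Variables (G : set_system R) (k : R).
Context {UG : UltraFilter G}.
Hypotheses (sG : (0 : R)^' `<=` G) (Dk : D h @[h --> G] --> k).

Let r_cvg i : D h - q i h @[h --> G] --> k - d i.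
Proof. by apply: cvgB => //; apply: cvg_trans (@q_cvg i); apply: cvg_app. Qed.

Let neq0 : \forall h \near G, h != 0.
Proof.
have H : \forall h \near (0 : R)^', h != 0 by exact: nbhs_dnbhs_neq.
exact: sG.
Qed.

Let flat_ppow i : b i = 0 -> e i h / ppow p h @[h --> G] --> ppow p (k - d i).
Proof.
move=> bi; have : ppow p (D h - q i h) @[h --> G] --> ppow p (k - d i).
  by apply: continuous_cvg; [exact: continuous_ppow|exact: r_cvg].
apply: cvg_trans; apply: near_eq_cvg; near=> h.
have h0 : h != 0 by near: h; exact: neq0.
rewrite eE// bi ppow0 add0r subr0 ppowM mulrC mulKf// ppow_eq0//.
Unshelve. all: by end_near. Qed.

Let steep_id i : b i != 0 ->
  e i h / h @[h --> G] --> (p - 1) * `|b i| `^ (p - 2) * (k - d i).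
Proof.
move=> bi; have [g [gE gc <-]] := (is_derive1_caratheodory _ _ _).1 (is_derive_ppow p1 bi).
have hr : b i + h * (D h - q i h) @[h --> G] --> b i.
  rewrite -[X in _ --> X]addr0 -[X in _ + X](mul0r (k - d i)).
  apply: cvgD; first exact: cvg_cst.
  apply: cvgM; last exact: r_cvg.
  have id0 : h @[h --> (0 : R)^'] --> (0 : R) by exact: cvg_within.
  by move=> U U0; apply: sG; exact: id0.
have : g (b i + h * (D h - q i h)) * (D h - q i h) @[h --> G] --> g (b i) * (k - d i).
  apply: cvgM; last exact: r_cvg.
  exact: continuous_cvg gc hr.
apply: cvg_trans; apply: near_eq_cvg; near=> h.
have h0 : h != 0 by near: h; exact: neq0.
by rewrite eE// gE; field.
Unshelve. all: by end_near. Qed.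

(** A term whose datum meets the mean at [t0] is exactly [ppow p h] times the
    odd power of [D h - q i h]. *)
Lemma flat_limits i : b i = 0 ->
  e i h / ppow p h @[h --> G] --> ppow p (k - d i) /\
  (forall L : R, `|h| `^ (p - 2) @[h --> (0 : R)^'] --> L ->
    e i h / h @[h --> G] --> L * ppow p (k - d i)).
Proof.
move=> bi; split; first exact: flat_ppow.
move=> L HL; have HL' : `|h| `^ (p - 2) @[h --> G] --> L.
  by apply: cvg_trans HL; apply: cvg_app.
have : `|h| `^ (p - 2) * (e i h / ppow p h) @[h --> G] --> L * ppow p (k - d i).
  by apply: cvgM => //; exact: flat_ppow.
apply: cvg_trans; apply: near_eq_cvg; near=> h.
have h0 : h != 0 by near: h; exact: neq0.
have ph0 : `|h| `^ (p - 2) != 0 by rewrite gt_eqF// powR_gt0// normr_gt0.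
by rewrite /ppow; field; rewrite h0 ph0.
Unshelve. all: by end_near. Qed.

(** At the other data the odd power is differentiable, so its increment is of
    order [h]. *)
Lemma steep_limits i : b i != 0 ->
  e i h / h @[h --> G] --> (p - 1) * `|b i| `^ (p - 2) * (k - d i) /\
  (forall L : R, `|h| `^ (2 - p) @[h --> (0 : R)^'] --> L ->
    e i h / ppow p h @[h --> G] --> L * ((p - 1) * `|b i| `^ (p - 2) * (k - d i))).
Proof.
move=> bi; split; first exact: steep_id.
move=> L HL; have HL' : `|h| `^ (2 - p) @[h --> G] --> L.
  by apply: cvg_trans HL; apply: cvg_app.
have : `|h| `^ (2 - p) * (e i h / h) @[h --> G] -->
    L * ((p - 1) * `|b i| `^ (p - 2) * (k - d i)).
  by apply: cvgM => //; exact: steep_id.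
apply: cvg_trans; apply: near_eq_cvg; near=> h.
have h0 : h != 0 by near: h; exact: neq0.
have ph0 : `|h| `^ (p - 2) != 0 by rewrite gt_eqF// powR_gt0// normr_gt0.
have -> : 2 - p = - (p - 2) by ring.
by rewrite powRN /ppow; field; rewrite h0 ph0.
Unshelve. all: by end_near. Qed.
End limits.

(** The scale is the larger of [|h| ^ (p - 1)], if some datum meets the mean,
    and [|h|], if some datum does not: the terms of the other kind then vanish
    in the limit, or have the same order when [p = 2]. *)
Lemma pmean_quotient_cvg : exists k : R, D h @[h --> (0 : R)^'] --> k.
Proof.
have slope_gt0 i : b i != 0 -> 0 < (p - 1) * `|b i| `^ (p - 2).
  by move=> bi; rewrite mulr_gt0 ?subr_gt0// powR_gt0// normr_gt0.
have [[j cj bj]|steep] := pselect (exists2 i, 0 < c i & b i = 0).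
  have [p2|p2] := leP p 2.
    have [|L L0 HL] := @cvg_norm_powR_dnbhs0 (2 - p); first by rewrite subr_ge0.
    apply: (@scaled_limit (ppow p) (fun i k => if b i == 0 then ppow p (k - d i)
      else L * ((p - 1) * `|b i| `^ (p - 2) * (k - d i)))).
    - move=> i k k' _ kk; case: ifPn => bi; first by rewrite ler_ppow// lerB.
      by rewrite ler_wpM2l// ler_wpM2l ?(ltW (slope_gt0 _ bi))// lerB.
    - by exists j => // k k' kk; rewrite bj eqxx ltr_ppow// ltrD2r.
    - move=> G k UG sG Dk i ci; case: ifPn => bi.
        by have [] := flat_limits sG Dk (eqP bi).
      by have [_] := steep_limits sG Dk bi; apply.
  have [[j' cj' bj']|flat] := pselect (exists2 i, 0 < c i & b i != 0).
    have [|L L0 HL] := @cvg_norm_powR_dnbhs0 (p - 2); first by rewrite subr_ge0 ltW.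
    apply: (@scaled_limit id (fun i k => if b i == 0 then L * ppow p (k - d i)
      else (p - 1) * `|b i| `^ (p - 2) * (k - d i))).
    - move=> i k k' _ kk; case: ifPn => bi.
        by rewrite ler_wpM2l// ler_ppow// lerB.
      by rewrite ler_wpM2l ?(ltW (slope_gt0 _ bi))// lerB.
    - by exists j' => // k k' kk; rewrite (negbTE bj') ltr_pM2l ?slope_gt0// ltrD2r.
    - move=> G k UG sG Dk i ci; case: ifPn => bi.
        by have [_] := flat_limits sG Dk (eqP bi); apply.
      by have [] := steep_limits sG Dk bi.
  apply: (@scaled_limit (ppow p) (fun i k => ppow p (k - d i))).
  - by move=> i k k' _ kk; rewrite ler_ppow// lerB.
  - by exists j => // k k' kk; rewrite ltr_ppow// ltrD2r.
  - move=> G k UG sG Dk i ci; have bi : b i = 0.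
      by apply: contrapT => /eqP bi; apply: flat; exists i.
    by have [] := flat_limits sG Dk bi.
have ci0 i : 0 < c i -> b i != 0.
  by move=> ci; apply/eqP => bi; apply: steep; exists i.
apply: (@scaled_limit id (fun i k => (p - 1) * `|b i| `^ (p - 2) * (k - d i))).
- by move=> i k k' /ci0 bi kk; rewrite ler_wpM2l ?(ltW (slope_gt0 _ bi))// lerB.
- have [j cj] := c_gt0; exists j => // k k' kk.
  by rewrite ltr_pM2l ?ltrD2r// slope_gt0// ci0.
- by move=> G k UG sG Dk i /ci0 bi; have [] := steep_limits sG Dk bi.
Qed.

End PMeanDerivable.

Lemma derivable_pbalance (R : realType) (I : finType) (p : R) (c : I -> R)
    (X : I -> R -> R) (Z : R -> R) (t0 : R) :
  1 < p -> (forall i, 0 <= c i) -> (exists i, 0 < c i) ->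
  (forall t, pbalance p c (X^~ t) (Z t) = 0) ->
  (forall i, derivable (X i) t0 1) -> derivable Z t0 1.
Proof.
move=> p1 c0 c1 bal dX.
have quot (f : R -> R) : (fun h : R => h^-1 *: ((f \o shift t0) (h *: 1) - f t0))
    = (fun h => h^-1 * (f (h + t0) - f t0)).
  by apply/funext => h /=; rewrite [h *: 1]mulr1.
have [|k Hk] := @pmean_quotient_cvg _ _ p c p1 c0 c1 X Z t0 (fun i => 'D_1 (X i) t0) bal.
  move=> i; have := dX i; rewrite /derivable quot => /cvg_ex[l Hl].
  by rewrite /derive quot (cvg_lim _ Hl).
by rewrite /derivable quot; apply/cvg_ex; exists k.
Qed.

Lemma is_derive_expansion (R : realType) (f : R -> R) (t a : R) :
  (forall e : R, 0 < e ->
    \forall s \near t, `|f s - f t - a * (s - t)| <= e * `|s - t|) ->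
  is_derive t (1 : R) f a.
Proof.
move=> H; apply/is_derive1_caratheodory.
pose g (z : R) := if z == t then a else (f z - f t) / (z - t).
exists g; split; last by rewrite /g eqxx.
- move=> z; rewrite /g; case: eqP => [->|/eqP]; first by rewrite !subrr mulr0.
  by rewrite -subr_eq0 => /divfK->.
apply/cvgrPdist_le => e e0; near=> z; rewrite /g eqxx.
case: eqP => [_|/eqP zt]; first by rewrite subrr normr0 ltW.
have zt0 : z - t != 0 by rewrite subr_eq0.
rewrite distrC -(ler_pM2r (_ : 0 < `|z - t|)) ?normr_gt0//.
rewrite -normrM mulrBl divfK//.
by near: z; exact: H.
Unshelve. all: by end_near. Qed.

(** * Peano's existence theorem *)

Section Peano.
Context {R : realType} {V : finType}.
Variables (G : (V -> R) -> V -> R) (a : V -> R).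

(** Boxes express continuity without a choice of topology on [V -> R]. *)
Definition sup_continuous := forall U (e : R), 0 < e ->
  exists2 n : R, 0 < n & forall W, (forall y, `|W y - U y| < n) ->
    forall x, `|G W x - G U x| < e.

Hypothesis Gcont : sup_continuous.

Fixpoint euler (h : R) (k : nat) : V -> R :=
  if k is k'.+1 then fun x => euler h k' x + h * G (euler h k') x else a.

(** The increment is the sum of [n] steps, each with a slope within [e] of [g]. *)
Let euler_secant (h e : R) (g : R) (x : V) (j n : nat) : 0 <= h ->
  (forall i, (j <= i < j + n)%N -> `|G (euler h i) x - g| <= e) ->
  `|euler h (j + n) x - euler h j x - n%:R * h * g| <= e * (n%:R * h).
Proof.
move=> h0; elim: n => [|n IH] Hi.
  by rewrite addn0 subrr !mul0r mulr0 subr0 normr0.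
have {}IH : `|euler h (j + n) x - euler h j x - n%:R * h * g| <= e * (n%:R * h).
  by apply: IH => i /andP[ji ijn]; apply: Hi; rewrite ji addnS ltnS ltnW.
have Hn : `|G (euler h (j + n)) x - g| <= e by apply: Hi; rewrite leq_addr addnS ltnSn.
rewrite addnS /=.
have -> : euler h (j + n) x + h * G (euler h (j + n)) x - euler h j x - n.+1%:R * h * g
  = (euler h (j + n) x - euler h j x - n%:R * h * g) + h * (G (euler h (j + n)) x - g).
  by rewrite -natr1; ring.
apply: le_trans (ler_normD _ _) _.
have -> : e * (n.+1%:R * h) = e * (n%:R * h) + h * e by rewrite -natr1; ring.
by apply: lerD => //; rewrite normrM ger0_norm// ler_wpM2l.
Qed.

(** Euler polygons with step [h n] take, near a time [t], slopes within [e] of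
    [G (u t)] as soon as [h n] is small, because the polygons are Lipschitz with
    a common constant and [G] is continuous at [u t].  The bound on secants
    obtained from [euler_secant] passes to the pointwise limit [u] along an
    ultrafilter, which therefore has slope [G (u t)] at [t].  The conclusion is
    stated for times in the closed interval, so that it contains the one-sided
    derivatives at both ends. *)
Lemma peano : exists2 del : R, 0 < del & exists u : R -> V -> R,
  u 0 = a /\
  forall t x (e : R), 0 <= t <= del -> 0 < e ->
    exists2 n : R, 0 < n & forall s, 0 <= s <= del -> `|s - t| < n ->
      `|u s x - u t x - G (u t) x * (s - t)| <= e * `|s - t|.
Proof.
have [r r0 Gr] := Gcont a (@ltr01 R).
pose M := 1 + \sum_x `|G a x|.
have M0 : 0 < M by rewrite ltr_wpDr// sumr_ge0.
have GM W x : (forall y, `|W y - a y| < r) -> `|G W x| <= M.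
  move=> Wr; have -> : G W x = (G W x - G a x) + G a x by ring.
  apply: le_trans (ler_normD _ _) _; apply: lerD; first by rewrite ltW// Gr.
  by rewrite (bigD1 x)//= lerDl sumr_ge0.
pose del := r / (2 * M).
have del0 : 0 < del by rewrite divr_gt0// mulr_gt0.
have delM : del * M = r / 2 by rewrite /del; field; rewrite gt_eqF.
pose h (n : nat) : R := del * harmonic n.
have h0 n : 0 < h n by rewrite mulr_gt0// harmonic_gt0.
have hto0 : h n @[n --> \oo] --> (0 : R).
  rewrite -(mulr0 del); apply: cvgM; [exact: cvg_cst|exact: cvg_harmonic].
(* As del * M = r / 2, no polygon leaves the ball on which M bounds G. *)
have stay n k x : k%:R * h n <= del -> `|euler (h n) k x - a x| <= r / 2.
  move=> kdel; suff H : forall x, `|euler (h n) k x - a x| <= k%:R * h n * M.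
    by apply: le_trans (H x) _; rewrite -delM ler_pM2r.
  elim: k kdel {x} => [|k IH] kdel x /=; first by rewrite subrr normr0 !mul0r.
  have kdel' : k%:R * h n <= del.
    by apply: le_trans kdel; rewrite ler_pM2r// ler_nat.
  have {}IH := IH kdel'.
  rewrite addrAC; apply: le_trans (ler_normD _ _) _.
  rewrite -natr1 mulrDl mul1r mulrDl; apply: lerD; first exact: IH.
  rewrite normrM gtr0_norm// ler_pM2l//; apply: GM => y.
  apply: le_lt_trans (IH y) _.
  apply: (@le_lt_trans _ _ (del * M)); first by rewrite ler_pM2r.
  by rewrite delM ltr_pdivrMr// mulr_natr mulr2n ltrDl.
pose k n (t : R) := Num.truncn (t / h n).
have kP n t : 0 <= t -> (k n t)%:R * h n <= t < (k n t)%:R * h n + h n.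
  move=> t0; have := @truncn_itv _ (t / h n) (divr_ge0 t0 (ltW (h0 n))).
  by rewrite -/(k n t) ler_pdivlMr// ltr_pdivrMr// -natr1 mulrDl mul1r.
pose v n t := euler (h n) (k n t).
have GMe n i x : i%:R * h n <= del -> `|G (euler (h n) i) x| <= M.
  move=> idel; apply: GM => y; apply: le_lt_trans (stay n i y idel) _.
  by rewrite ltr_pdivrMr// mulr_natr mulr2n ltrDl.
have PFoo : ProperFilter (\oo : set_system nat) by exact: eventually_filter.
have [F [UF sF]] := ultraFilterLemma PFoo.
have hF : h n @[n --> F] --> (0 : R) by move=> A /hto0; exact: sF.
have vlim t x : 0 <= t <= del -> exists l : R, v n t x @[n --> F] --> l.
  move=> /andP[t0 tdel].
  apply: (@ultra_bounded_cvg _ _ F UF (fun n => v n t x) (`|a x| + r / 2)).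
  apply: nearW => n.
  have -> : v n t x = a x + (v n t x - a x) by ring.
  apply: le_trans (ler_normD _ _) _; rewrite lerD2l; apply: stay.
  by have /andP[H _] := kP n t t0; exact: le_trans H tdel.
pose u t x : R := xget 0 [set l | v n t x @[n --> F] --> l].
have uP t x : 0 <= t <= del -> v n t x @[n --> F] --> u t x.
  move=> /(vlim t x) H.
  exact: (@xgetPex _ 0 [set l : R | v n t x @[n --> F] --> l] H).
exists del => //; exists u; split.
  apply/funext => x.
  have H0 : v n 0 x @[n --> F] --> a x.
    have -> : (fun n => v n 0 x) = (fun=> a x); last exact: cvg_cst.
    by apply/funext => n; rewrite /v /k mul0r truncn0.
  apply: (cvg_unique _ (uP _ _ _) H0); first exact: Rhausdorff.
  by rewrite lexx ltW.
move=> t x e tdel e0.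
have [eta eta0 Geta] := Gcont (u t) e0.
pose kap := eta / (4 * M).
have kap0 : 0 < kap by rewrite divr_gt0// mulr_gt0.
have kapM : kap * M = eta / 4 by rewrite /kap; field; rewrite gt_eqF.
exists kap => // s sdel st.
(* Both signs of [s - t] reduce to a secant from left to right that meets [t]. *)
have secant s1 s2 : 0 <= s1 -> s1 <= s2 -> s2 <= del -> s2 - s1 < kap ->
    (s1 <= t <= s2) ->
    `|u s2 x - u s1 x - G (u t) x * (s2 - s1)| <= e * (s2 - s1).
  move=> s10 s12 s2del s2s1 /andP[s1t ts2].
  have s1del : s1 <= del by exact: le_trans s2del.
  have s20 : 0 <= s2 by exact: le_trans s12.
  pose m n := (k n s2 - k n s1)%N.
  have mE n : (k n s1 + m n)%N = k n s2.
    rewrite subnKC//; apply: le_truncn; rewrite ler_pM2r// invr_gt0//.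
  have mh n : `|(m n)%:R * h n - (s2 - s1)| <= h n.
    have := kP n _ s10; have := kP n _ s20; rewrite -mE natrD mulrDl.
    move=> /andP[A1 A2] /andP[A3 A4].
    by rewrite ler_distl; apply/andP; split; lra.
  have mlim : (m n)%:R * h n @[n --> F] --> s2 - s1.
    apply/cvgrPdist_le => d d0; near=> n; rewrite distrC; apply: le_trans (mh n) _.
    near: n; move/cvgr0Pnorm_le : hF => /(_ _ d0); apply: filterS => n.
    by rewrite gtr0_norm.
  have lhs : e * ((m n)%:R * h n)
      - `|v n s2 x - v n s1 x - (m n)%:R * h n * G (u t) x| @[n --> F]
      --> e * (s2 - s1) - `|u s2 x - u s1 x - (s2 - s1) * G (u t) x|.
    apply: cvgB; first by apply: cvgM => //; exact: cvg_cst.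
    apply: cvg_norm; apply: cvgB; first by apply: cvgB; apply: uP; apply/andP.
    by apply: cvgM => //; exact: cvg_cst.
  rewrite -subr_ge0 [G (u t) x * _]mulrC; apply: (cvgr_to_ge lhs).
  have vt : \forall n \near F, forall y, `|u t y - v n t y| <= eta / 4.
    apply: filter_forall => y.
    by move/cvgrPdist_le : (@uP t y tdel); apply; rewrite divr_gt0.
  have hn : \forall n \near F, h n * M < eta / 4.
    have e4 : 0 < eta / 4 / M by rewrite !divr_gt0.
    move/cvgr0Pnorm_lt : hF => /(_ _ e4); apply: filterS => n.
    by rewrite gtr0_norm// ltr_pdivlMr.
  near=> n; rewrite subr_ge0 /v -mE; apply: euler_secant; first exact: ltW.
  move=> i /andP[ji ijn]; apply/ltW/Geta => y.
  have vtn : `|u t y - v n t y| <= eta / 4 by move: y; near: n; exact: vt.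
  have hnn : h n * M < eta / 4 by near: n; exact: hn.
  have t0 : 0 <= t by exact: le_trans s1t.
  have ktdel : (k n s2)%:R * h n <= del.
    by have /andP[A _] := kP n _ s20; exact: le_trans s2del.
  have lip j l : (j <= l <= k n s2)%N ->
      `|euler (h n) l y - euler (h n) j y| <= M * ((l - j)%:R * h n).
    move=> /andP[jl lk].
    have := @euler_secant (h n) M 0 y j (l - j) (ltW (h0 n)).
    rewrite subnKC// mulr0 subr0; apply => i' /andP[_ i'l]; rewrite subr0; apply: GMe.
    apply: le_trans ktdel; rewrite ler_pM2r// ler_nat.
    by rewrite (leq_trans (ltnW i'l)).
  have kt1 : (k n s1 <= k n t)%N by apply: le_truncn; rewrite ler_pM2r// invr_gt0.
  have kt2 : (k n t <= k n s2)%N by apply: le_truncn; rewrite ler_pM2r// invr_gt0.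
  have width j l : (k n s1 <= j)%N -> (j <= l <= k n s2)%N ->
      M * ((l - j)%:R * h n) <= eta / 2.
    move=> kj /andP[jl lk].
    have : (l - j)%:R * h n <= (m n)%:R * h n by rewrite ler_pM2r// ler_nat leq_sub.
    have := mh n; rewrite ler_distl => /andP[_ A] B.
    have : (l - j)%:R * h n <= kap + h n by lra.
    rewrite -(ler_pM2l M0); move/le_trans; apply.
    rewrite mulrDr mulrC kapM [M * _]mulrC.
    by move: hnn; lra.
  have close : `|euler (h n) i y - v n t y| <= eta / 2.
    rewrite /v; have [ik|ki] := leqP i (k n t).
      rewrite distrC; apply: le_trans (lip _ _ _) (width _ _ _ _) => //; apply/andP; split => //.
    have iks : (i <= k n s2)%N by rewrite -mE ltnW.
    apply: le_trans (lip _ _ _) (width _ _ _ _) => //; rewrite ltnW//.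
  have -> : euler (h n) i y - u t y = (euler (h n) i y - v n t y) + (v n t y - u t y) by ring.
  apply: le_lt_trans (ler_normD _ _) _; rewrite [`|v n t y - _|]distrC.
  by apply: le_lt_trans (lerD close vtn) _; lra.
have /andP[s0 s1] := sdel; have /andP[t0 t1] := tdel.
have [ts|st'] := leP t s.
  have st0 : 0 <= s - t by rewrite subr_ge0.
  move: st; rewrite ger0_norm// => st.
  by apply: secant => //; rewrite lexx.
have st0 : s - t < 0 by rewrite subr_lt0.
move: st; rewrite ltr0_norm// opprB => st.
have -> : u s x - u t x - G (u t) x * (s - t) = - (u t x - u s x - G (u t) x * (t - s)) by ring.
by rewrite normrN; apply: secant => //; rewrite ?lexx ltW.
Unshelve. all: by end_near. Qed.

End Peano.

(** * The primitive of a continuous function *)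

Section Primitive.
Context {R : realType}.

(** Near [s] the oriented integral differs by a constant from the integral from
    a base point [a] to the left of both [0] and [s]. *)
Lemma is_derive_primitive0 (f : R -> R) (s : R) : continuous f ->
  is_derive s (1 : R) (primitive0 f) (f s).
Proof.
move=> cf; pose mu := @lebesgue_measure R.
have intf a b : mu.-integrable `[a, b] (EFin \o f).
  apply: continuous_compact_integrable; first exact: segment_compact.
  by apply: continuous_subspaceT => x; exact: cf.
pose a := Num.min 0 s - 1.
have a0 : a < 0 by rewrite /a ltrBlDr add0r gt_min ltr01.
have as_ : a < s by rewrite /a ltrBlDr gt_min ltrDl ltr01 orbT.
pose F y := \int[mu]_(x in `[a, y]) f x.
have [dF F's] := @continuous_FTC1_closed R f a s (s + 1) (ltr_pwDr ltr01 (lexx s))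
  (intf _ _) as_ (cf s).
have E : \forall y \near s, F y - F 0 = primitive0 f y.
  near=> y; have ay : a < y by near: y; exact: lt_nbhsr.
  have Fdiff (b c : R) : a <= b -> b <= c -> F c - F b = \int[mu]_(x in `[b, c]) f x.
    move=> ab bc; rewrite /F (@Rintegral_itvB _ f (BLeft a) (BRight c) b)//.
    rewrite Rintegral_itv_obnd_cbnd//.
    by apply: integrableS (intf b c) => //; exact: subset_itv_oc_cc.
  rewrite /primitive0; case: ifPn => y0.
    by rewrite Fdiff// ltW.
  by rewrite -Fdiff ?opprB// ltW// ltNge.
apply: (near_eq_is_derive E).
rewrite -[f s]subr0 -F's derive1E.
by apply: is_deriveB; exact: DeriveDef.
Unshelve. all: by end_near. Qed.

Lemma primitive00 (f : R -> R) : primitive0 f 0 = 0.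
Proof. by rewrite /primitive0 lexx set_itv1 Rintegral_set1. Qed.

End Primitive.

(** * Differential inequalities *)

Lemma within_continuousP (R : realType) (A : set R) (f : R -> R) :
  {within A, continuous f} <->
  (forall x, A x -> f y @[y --> within A (nbhs x)] --> f x).
Proof.
split; first by move=> /subspace_continuousP cf x Ax; exact: (cf x Ax).
by move=> cf; apply/subspace_continuousP => x Ax; exact: (cf x Ax).
Qed.

Section Calculus.
Context {R : realType}.
Variable T : \bar R.

Definition lifespan : set R := [set t : R | 0 <= t /\ (t%:E < T)%E].

Lemma ndecr_segment (y dy : R -> R) (s t : R) : {within lifespan, continuous y} ->
  0 <= s -> s <= t -> (t%:E < T)%E ->
  (forall r, s < r < t -> is_derive r (1 : R) y (dy r)) ->
  (forall r, s < r < t -> 0 <= dy r) -> y s <= y t.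
Proof.
move=> cy s0 st tT dyE dy0.
have sub x : x \in `]s, t[ -> s < x < t by rewrite in_itv.
have := @ger0_derive1_ndecr R y s t _ _ _ s t (lexx s) st (lexx t); apply.
- by move=> x /sub xst; have [] := dyE x xst.
- move=> x /sub xst; have [_ yE] := dyE x xst.
  by rewrite derive1E yE; exact: dy0.
- apply: continuous_subspaceW cy => x /=; rewrite in_itv /= => /andP[sx xt].
  by split; [exact: le_trans sx|apply: le_lt_trans tT; rewrite lee_fin].
Qed.

Lemma ndecr_lifespan (y dy : R -> R) : {within lifespan, continuous y} ->
  (forall t, 0 < t -> (t%:E < T)%E -> is_derive t (1 : R) y (dy t)) ->
  (forall t, 0 < t -> (t%:E < T)%E -> 0 <= dy t) ->
  forall s t, 0 <= s -> s <= t -> (t%:E < T)%E -> y s <= y t.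
Proof.
move=> cy dyE dy0 s t s0 st tT.
have sub r : s < r < t -> 0 < r /\ (r%:E < T)%E.
  move=> /andP[sr rt]; split; first exact: le_lt_trans sr.
  by apply: lt_trans tT; rewrite lte_fin.
apply: (@ndecr_segment y dy) => // r /sub[r0 rT]; [exact: dyE|exact: dy0].
Qed.

Lemma powR_continuous_gt0 (a x : R) : 0 < x -> {for x, continuous (fun y : R => y `^ a)}.
Proof.
move=> x0; apply/differentiable_continuous/derivable1_diffP.
by have [] := is_derive1_powR a x0.
Qed.

Lemma within_comp_powR (y : R -> R) a : {within lifespan, continuous y} ->
  (forall t, lifespan t -> 0 < y t) ->
  {within lifespan, continuous (fun t => y t `^ a)}.
Proof.
move=> /within_continuousP cy y0; apply/within_continuousP => t tT.
have pc := @powR_continuous_gt0 a (y t) (y0 t tT).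
exact: (@continuous_cvg _ _ _ _ _ _ (fun z : R => z `^ a) _ pc (cy t tT)).
Qed.

Lemma is_derive_comp_powR (y : R -> R) (dy a t : R) : 0 < y t ->
  is_derive t (1 : R) y dy ->
  is_derive t (1 : R) (fun s => y s `^ a) (a * y t `^ (a - 1) * dy).
Proof. by move=> y0 dyE; exact: (is_derive1_comp (is_derive1_powR a y0) dyE). Qed.

(** [y ^ (- e) + e c t] is nonincreasing and [y ^ (- e)] is positive. *)
Lemma superlinear_finite_time (y dy : R -> R) (c e : R) : 0 < c -> 0 < e ->
  (0 < T)%E -> {within lifespan, continuous y} ->
  (forall t, 0 < t -> (t%:E < T)%E -> is_derive t (1 : R) y (dy t)) ->
  0 < y 0 ->
  (forall t, 0 < t -> (t%:E < T)%E -> c * y t `^ (1 + e) <= dy t) ->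
  exists K : R, forall t, lifespan t -> t <= K.
Proof.
move=> c0 e0 T0 cy dyE y0 ineq.
have ndecr := ndecr_lifespan cy dyE.
have dy0 t : 0 < t -> (t%:E < T)%E -> 0 <= dy t.
  by move=> t0 tT; apply: le_trans (ineq t t0 tT); rewrite mulr_ge0 ?powR_ge0// ltW.
have ypos t : lifespan t -> 0 < y t.
  by move=> [t0 tT]; apply: lt_le_trans y0 _; exact: ndecr.
exists (y 0 `^ (- e) / (e * c)) => t [t0 tT].
pose z t := - (y t `^ (- e) + e * c * t).
have cz : {within lifespan, continuous z}.
  have /within_continuousP c1 := within_comp_powR (a := - e) cy ypos.
  apply/within_continuousP => s sT; apply: cvgN; apply: cvgD; first exact: c1.
  by apply: cvgM; [exact: cvg_cst|exact: cvg_within].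
have dz s : 0 < s -> (s%:E < T)%E ->
    is_derive s (1 : R) z (- (- e * y s `^ (- e - 1) * dy s + e * c)).
  move=> s0 sT; apply: is_deriveN; apply: is_deriveD.
    apply: is_derive_comp_powR; last exact: dyE.
    by apply: ypos; split => //; exact: ltW.
  have := is_deriveZ (e * c) (is_derive_id s (1 : R)).
  by rewrite [_ *: _]mulr1.
have := @ndecr_lifespan z _ cz dz _ 0 t (lexx 0) t0 tT.
rewrite /z mulr0 addr0 lerN2 => H.
rewrite ler_pdivlMr ?mulr_gt0// mulrC.
apply: le_trans (H _); first by rewrite lerDr powR_ge0.
move=> s s0 sT.
have ys : 0 < y s by apply: ypos; split => //; exact: ltW.
rewrite oppr_ge0 -subr_ge0 sub0r opprD mulNr mulNr opprK subr_ge0 -mulrA ler_pM2l//.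
apply: le_trans (ler_wpM2l (powR_ge0 _ _) (ineq s s0 sT)).
rewrite mulrCA -powRD; last by rewrite (gt_eqF ys) implybT.
by rewrite (_ : - e - 1 + (1 + e) = 0) ?powRr0 ?mulr1//; ring.
Qed.

(** From [2 alpha En dJ <= dJ ^ 2 <= 4 J dE] follows
    [alpha / 2 * dJ / J <= dE / En], that is, [En * J ^ (- alpha / 2)] is
    nondecreasing.  Its initial value bounds [En], and hence [dJ], from below by
    a multiple of [J ^ (alpha / 2)]. *)
Lemma levine_concavity (J dJ En dE : R -> R) (alpha : R) : 2 < alpha ->
  (0 < T)%E ->
  {within lifespan, continuous J} -> {within lifespan, continuous En} ->
  (forall t, 0 < t -> (t%:E < T)%E -> is_derive t (1 : R) J (dJ t)) ->
  (forall t, 0 < t -> (t%:E < T)%E -> is_derive t (1 : R) En (dE t)) ->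
  0 < J 0 -> 0 < En 0 ->
  (forall t, 0 < t -> (t%:E < T)%E -> 0 <= dE t) ->
  (forall t, 0 < t -> (t%:E < T)%E -> 2 * alpha * En t <= dJ t) ->
  (forall t, 0 < t -> (t%:E < T)%E -> dJ t ^+ 2 <= 4 * J t * dE t) ->
  exists2 c : R, 0 < c & forall t, 0 < t -> (t%:E < T)%E ->
    c * J t `^ (1 + (alpha / 2 - 1)) <= dJ t.
Proof.
move=> a2 T0 cJ cE dJE dEE J0 E0 dE0 dJge dJsq.
have a0 : 0 < alpha by apply: lt_trans a2.
have Epos t : lifespan t -> 0 < En t.
  move=> [t0 tT]; apply: lt_le_trans E0 _.
  exact: (ndecr_lifespan cE dEE dE0).
have dJ0 t : 0 < t -> (t%:E < T)%E -> 0 < dJ t.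
  move=> t0 tT; apply: lt_le_trans (dJge t t0 tT).
  rewrite !mulr_gt0// Epos//; split => //; exact: ltW.
have Jpos t : lifespan t -> 0 < J t.
  move=> [t0 tT]; apply: lt_le_trans J0 _.
  by apply: (ndecr_lifespan cJ dJE) => // s s0 sT; apply/ltW/dJ0.
pose b := alpha / 2.
pose W t := En t * J t `^ (- b).
have cW : {within lifespan, continuous W}.
  have /within_continuousP c1 := within_comp_powR (a := - b) cJ Jpos.
  move/within_continuousP : cE => c2.
  by apply/within_continuousP => s sT; apply: cvgM; [exact: c2|exact: c1].
have dW s : 0 < s -> (s%:E < T)%E ->
    is_derive s (1 : R) W (En s * (- b * J s `^ (- b - 1) * dJ s) + J s `^ (- b) * dE s).
  move=> s0 sT.
  have Js : 0 < J s by apply: Jpos; split => //; exact: ltW.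
  exact: is_deriveM (dEE s s0 sT) (is_derive_comp_powR (- b) Js (dJE s s0 sT)).
have W0 : 0 < W 0 by rewrite mulr_gt0// powR_gt0.
exists (2 * alpha * W 0); first by rewrite mulr_gt0// mulr_gt0.
move=> t t0 tT; apply: le_trans (dJge t t0 tT).
have tl : lifespan t by split => //; exact: ltW.
have Jt := Jpos t tl.
have EW : En t = W t * J t `^ b.
  by rewrite /W -mulrA -powRD ?addNr ?powRr0 ?mulr1// (gt_eqF Jt) implybT.
have -> : 1 + (alpha / 2 - 1) = b by rewrite /b; ring.
rewrite EW mulrA ler_pM2r ?powR_gt0// ler_pM2l ?mulr_gt0//.
apply: (ndecr_lifespan cW dW) => //; last exact: ltW.
move=> s s0 sT.
have sl : lifespan s by split => //; exact: ltW.
have Js := Jpos s sl.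
have -> : J s `^ (- b) = J s `^ (- b - 1) * J s.
  rewrite -[X in _ * X](powRr1 (ltW Js)) -powRD ?subrK//.
  by rewrite (gt_eqF Js) implybT.
rewrite (_ : _ + _ = J s `^ (- b - 1) * (J s * dE s - b * En s * dJ s)); last by ring.
rewrite mulr_ge0 ?powR_ge0// subr_ge0.
have A := dJsq s s0 sT; have B := dJge s s0 sT; have C := dJ0 s s0 sT.
have D : 2 * alpha * En s * dJ s <= dJ s ^+ 2 by rewrite expr2 ler_pM2r.
by rewrite /b; lra.
Qed.

End Calculus.

(** [(c + e) x - y x] and [y x - (c - e) x] are nondecreasing. *)
Lemma secant_bound (R : realType) (T : \bar R) (y dy : R -> R) (c e s t : R) :
  {within lifespan T, continuous y} ->
  0 <= s -> s <= t -> (t%:E < T)%E ->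
  (forall r, s < r < t -> is_derive r (1 : R) y (dy r)) ->
  (forall r, s < r < t -> `|dy r - c| <= e) ->
  `|y t - y s - c * (t - s)| <= e * (t - s).
Proof.
move=> cy s0 st tT dyE dyc.
have lin k r : is_derive r (1 : R) (fun x => k * x) k.
  by have := is_derive_mull k (is_derive_id r (1 : R)); rewrite mulr1.
have clin k : {within lifespan T, continuous (fun x => k * x)}.
  by apply: continuous_subspaceT => x; apply: cvgM; [exact: cvg_cst|exact: cvg_id].
have up : (c + e) * s - y s <= (c + e) * t - y t.
  have := @ndecr_segment R T (fun x => (c + e) * x - y x) (fun x => (c + e) - dy x) s t.
  apply; [|exact: s0|exact: st|exact: tT| |].
  - by move=> x; apply: continuousB; [exact: clin|exact: cy].
  - by move=> r /dyE dr; apply: is_deriveB.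
  - by move=> r /dyc; rewrite ler_norml => /andP[]; lra.
have dn : y s - (c - e) * s <= y t - (c - e) * t.
  have := @ndecr_segment R T (fun x => y x - (c - e) * x) (fun x => dy x - (c - e)) s t.
  apply; [|exact: s0|exact: st|exact: tT| |].
  - by move=> x; apply: continuousB; [exact: cy|exact: clin].
  - by move=> r /dyE dr; apply: is_deriveB.
  - by move=> r /dyc; rewrite ler_norml => /andP[]; lra.
by rewrite ler_norml; apply/andP; split; lra.
Qed.

(** * Green's formula and the first eigenvalue *)

Section Forms.
Context {R : realType} {V : finType}.
Variables (E : rel V) (S : {set V}) (w : V -> V -> R) (p : R) (mu sigma : V -> R).
Hypotheses (w_weight : is_weight E w) (p1 : 1 < p)
  (mu_ge0 : forall z, z \in vboundary E S -> 0 <= mu z)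
  (sigma_ge0 : forall z, z \in vboundary E S -> 0 <= sigma z)
  (mu_sigma_gt0 : forall z, z \in vboundary E S -> 0 < mu z + sigma z).
Implicit Types u psi v phi : V -> R.

Let w_sym := weight_sym w_weight.
Let w_ge0 := weight_ge0 w_weight.

(** Neither the p-Laplacian on [S] nor the normal derivative sees the edges
    between two boundary vertices. *)
Definition inner_weight x y : R := if (x \in S) || (y \in S) then w x y else 0.

Lemma inner_weight_ge0 x y : 0 <= inner_weight x y.
Proof. by rewrite /inner_weight; case: ifP => // _; exact: w_ge0. Qed.

Lemma inner_weight_le x y : inner_weight x y <= w x y.
Proof. by rewrite /inner_weight; case: ifP. Qed.

Lemma inner_weightC x y : inner_weight x y = inner_weight y x.
Proof. by rewrite /inner_weight orbC w_sym. Qed.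

Definition dirichlet_form u psi : R :=
  2^-1 * \sum_(x in vclosure E S) \sum_(y in vclosure E S)
    ppow p (u x - u y) * (psi x - psi y) * inner_weight x y.

Definition robin_form u psi : R :=
  \sum_(z in Gamma_set E S mu) sigma z / mu z * (ppow p (u z) * psi z).

Definition weak_form u psi : R := dirichlet_form u psi + robin_form u psi.

Lemma sum_vclosure (g : V -> R) : \sum_(x in vclosure E S) g x =
  \sum_(x in S) g x + \sum_(z in vboundary E S) g z.
Proof.
rewrite (bigID (mem S))/=; congr (_ + _); apply: eq_bigl => x.
  by rewrite finset.in_setU; case: (x \in S); rewrite ?andbT ?andbF.
by rewrite !inE; case: (x \in S); rewrite ?andbT ?andbF.
Qed.

(** The kernel [ppow p (u x - u y) * inner_weight x y] is antisymmetric, so the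
    two halves of the double sum agree. *)
Lemma green u psi : dirichlet_form u psi =
  \sum_(x in S) psi x * (- pLaplacian E S w p u x)
  + \sum_(z in vboundary E S) psi z * pnormal S w p u z.
Proof.
pose K x y := ppow p (u x - u y) * inner_weight x y.
have KC x y : K y x = - K x y.
  by rewrite /K -[u y - u x]opprB ppowN mulNr inner_weightC.
have -> : dirichlet_form u psi = \sum_(x in vclosure E S) psi x * \sum_(y in vclosure E S) K x y.
  rewrite /dirichlet_form.
  transitivity (2^-1 * (\sum_(x in vclosure E S) \sum_(y in vclosure E S) K x y * psi x
     - \sum_(x in vclosure E S) \sum_(y in vclosure E S) K x y * psi y)).
    rewrite -sumrB; congr (_ * _); apply: eq_bigr => x _; rewrite -sumrB.
    by apply: eq_bigr => y _; rewrite /K; ring.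
  rewrite [X in _ - X]exchange_big /=.
  rewrite [X in _ - X](_ : _ =
    - \sum_(x in vclosure E S) \sum_(y in vclosure E S) K x y * psi x).
    rewrite opprK (_ : forall a : R, 2^-1 * (a + a) = a); last by move=> a; field.
    by apply: eq_bigr => x _; rewrite mulr_sumr; apply: eq_bigr => y _; rewrite mulrC.
  rewrite -sumrN; apply: eq_bigr => x _; rewrite -sumrN.
  by apply: eq_bigr => y _; rewrite KC mulNr.
rewrite sum_vclosure; congr (_ + _); apply: eq_bigr => x.
  move=> xS; congr (_ * _); rewrite -sumrN; apply: eq_bigr => y _.
  by rewrite /K /inner_weight xS -[u y - u x]opprB ppowN mulNr opprK.
rewrite inE => /andP[xS _]; congr (_ * _); rewrite sum_vclosure.
rewrite [X in _ + X]big1 ?addr0; last first.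
  move=> y; rewrite inE => /andP[yS _].
  by rewrite /K /inner_weight (negbTE xS) (negbTE yS) mulr0.
by apply: eq_bigr => y yS; rewrite /K /inner_weight yS orbT w_sym.
Qed.

Lemma Gamma_boundary z : z \in Gamma_set E S mu -> z \in vboundary E S /\ 0 < mu z.
Proof. by rewrite inE => /andP. Qed.

Lemma not_Gamma z : z \in vboundary E S -> z \notin Gamma_set E S mu -> mu z = 0.
Proof.
move=> zB; rewrite inE zB /= -leNgt => muz.
by apply/eqP; rewrite eq_le muz mu_ge0.
Qed.

Lemma boundary_dirichlet u z : z \in vboundary E S -> mu z = 0 ->
  boundary_op S w p mu sigma u z = 0 -> u z = 0.
Proof.
move=> zB muz; rewrite /boundary_op muz mul0r add0r => /eqP.
have := mu_sigma_gt0 zB; rewrite muz add0r => sz.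
by rewrite mulf_eq0 gt_eqF//= ppow_eq0// => /eqP.
Qed.

Definition vanishes_off_Gamma psi :=
  forall z, z \in vboundary E S -> mu z = 0 -> psi z = 0.

Definition satisfies_boundary u :=
  forall z, z \in vboundary E S -> boundary_op S w p mu sigma u z = 0.

(** Green's formula, with the normal derivative on [Gamma] replaced by means of
    the boundary condition; off [Gamma] it is multiplied by [0]. *)
Lemma weak_formulation u psi : satisfies_boundary u -> vanishes_off_Gamma psi ->
  \sum_(x in S) psi x * pLaplacian E S w p u x = - weak_form u psi.
Proof.
move=> bu psi0; rewrite /weak_form green.
have -> : \sum_(z in vboundary E S) psi z * pnormal S w p u z = - robin_form u psi.
  rewrite /robin_form -sumrN (bigID (mem (Gamma_set E S mu)))/=.
  rewrite [X in _ + X]big1 ?addr0; last first.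
    by move=> z /andP[zB zG]; rewrite psi0 ?mul0r// not_Gamma.
  apply: eq_big => [z|z /andP[zB zG]].
    by rewrite andb_idl// => /Gamma_boundary[].
  have [_ muz] := Gamma_boundary zG.
  have := bu z zB; rewrite /boundary_op => /eqP; rewrite addrC addr_eq0 => /eqP bz.
  have -> : sigma z / mu z * (ppow p (u z) * psi z)
    = (sigma z * ppow p (u z)) * psi z / mu z by ring.
  by rewrite bz; field; rewrite gt_eqF.
by rewrite addrNK -sumrN; apply: eq_bigr => x _; rewrite mulrN opprK.
Qed.

Lemma dirichlet_form_ge0 u psi :
  (forall x y, 0 <= (u x - u y) * (psi x - psi y)) -> 0 <= dirichlet_form u psi.
Proof.
move=> H; rewrite mulr_ge0 ?invr_ge0//; apply: sumr_ge0 => x _; apply: sumr_ge0 => y _.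
apply: mulr_ge0; last exact: inner_weight_ge0.
by rewrite /ppow -mulrA mulr_ge0 ?powR_ge0.
Qed.

Lemma robin_form_ge0 u psi : (forall x, 0 <= u x * psi x) -> 0 <= robin_form u psi.
Proof.
move=> H; apply: sumr_ge0 => z /Gamma_boundary[zB muz].
apply: mulr_ge0; first by rewrite divr_ge0 ?sigma_ge0// ltW.
by rewrite /ppow -mulrA mulr_ge0 ?powR_ge0.
Qed.

Lemma weak_form_ge0 u psi :
  (forall x y, 0 <= (u x - u y) * (psi x - psi y)) ->
  (forall x, 0 <= u x * psi x) -> 0 <= weak_form u psi.
Proof.
by move=> H1 H2; apply: addr_ge0; [exact: dirichlet_form_ge0|exact: robin_form_ge0].
Qed.

Lemma weak_form_diag u : weak_form u u =
  2^-1 * \sum_(x in vclosure E S) \sum_(y in vclosure E S)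
     `|u x - u y| `^ p * inner_weight x y
  + \sum_(z in Gamma_set E S mu) sigma z / mu z * `|u z| `^ p.
Proof.
congr (_ * _ + _).
  by apply: eq_bigr => x _; apply: eq_bigr => y _; rewrite ppow_mul.
by apply: eq_bigr => z _; rewrite ppow_mul.
Qed.

Lemma is_derive_weak_form (U : V -> R -> R) (dU : V -> R) (t : R) :
  (forall x, x \in vclosure E S -> is_derive t (1 : R) (U x) (dU x)) ->
  is_derive t (1 : R) (fun s => weak_form (U^~ s) (U^~ s)) (p * weak_form (U^~ t) dU).
Proof.
move=> HU.
have -> : (fun s => weak_form (U^~ s) (U^~ s)) = (fun s =>
    2^-1 * (\sum_(x in vclosure E S) \sum_(y in vclosure E S)
      `|U x s - U y s| `^ p * inner_weight x y)
    + \sum_(z in Gamma_set E S mu) sigma z / mu z * `|U z s| `^ p).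
  by apply/funext => s; rewrite weak_form_diag.
have dpow (g : R -> R) dg : is_derive t (1 : R) g dg ->
    is_derive t (1 : R) (fun s => `|g s| `^ p) (p * ppow p (g t) * dg).
  by move=> dgE; exact: (is_derive1_comp (is_derive_norm_powR (g t) p1) dgE).
rewrite /weak_form /dirichlet_form /robin_form mulrDr; apply: is_deriveD.
  rewrite mulrCA; apply: is_derive_mull; rewrite mulr_sumr.
  apply: is_derive_sumr => x xC; rewrite mulr_sumr; apply: is_derive_sumr => y yC.
  rewrite mulrA; apply: is_derive_mulr; rewrite mulrA.
  by apply: (dpow (fun s => U x s - U y s)); apply: is_deriveB; exact: HU.
rewrite mulr_sumr; apply: is_derive_sumr => z /Gamma_boundary[zB _].
rewrite mulrCA; apply: is_derive_mull; rewrite mulrA; apply: dpow; apply: HU.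
by rewrite finset.in_setU zB orbT.
Qed.

Lemma cvg_weak_form T (F : set_system T) (FF : Filter F) (U : V -> T -> R) (a : V -> R) :
  (forall x, x \in vclosure E S -> U x s @[s --> F] --> a x) ->
  weak_form (U^~ s) (U^~ s) @[s --> F] --> weak_form a a.
Proof.
move=> HU; rewrite weak_form_diag.
under eq_cvg do rewrite weak_form_diag.
have cpow (g : T -> R) l : g s @[s --> F] --> l -> `|g s| `^ p @[s --> F] --> `|l| `^ p.
  move=> gl; apply: (@continuous_cvg _ _ _ _ _ _ (fun z : R => `|z| `^ p)) => //.
  apply/differentiable_continuous/derivable1_diffP.
  by have [] := is_derive_norm_powR l p1.
apply: cvgD.
  apply: cvgM; first exact: cvg_cst.
  apply: cvg_sumr => x xC; apply: cvg_sumr => y yC.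
  apply: cvgM; last exact: cvg_cst.
  by apply: cpow; apply: cvgB; exact: HU.
apply: cvg_sumr => z /Gamma_boundary[zB _]; apply: cvgM; first exact: cvg_cst.
by apply: cpow; apply: HU; rewrite finset.in_setU zB orbT.
Qed.

Section Eigenvalue.
Variables (lambda : R) (phi : V -> R).
Hypotheses (phi_gt0 : forall x, x \in S :|: Gamma_set E S mu -> 0 < phi x)
  (phi_eig : forall x, x \in S -> - pLaplacian E S w p phi x = lambda * ppow p (phi x))
  (phi_bnd : satisfies_boundary phi).

Let phi_vanish : vanishes_off_Gamma phi.
Proof. by move=> z zB muz; apply: boundary_dirichlet => //; exact: phi_bnd. Qed.

Let closure_cases x : x \in vclosure E S ->
  0 < phi x \/ [/\ x \notin S, x \in vboundary E S & mu x = 0].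
Proof.
move=> xC; have [xSG|] := boolP (x \in S :|: Gamma_set E S mu); first by left; exact: phi_gt0.
rewrite finset.in_setU negb_or => /andP[xS xG]; right; move: xC.
rewrite finset.in_setU (negbTE xS) /= => xB.
by split => //; exact: not_Gamma.
Qed.

(** The weak formulation of the eigenvalue problem, tested against
    [|v| ^ p / ppow p phi], and Picone's inequality on each edge.  At a boundary
    vertex with [mu z = 0] both [phi] and [v] vanish, and Picone's inequality
    becomes an equality. *)
Lemma eigenvalue_le v : vanishes_off_Gamma v ->
  lambda * \sum_(x in S) `|v x| `^ p <= weak_form v v.
Proof.
move=> v0; pose psi x := `|v x| `^ p / ppow p (phi x).
have p0 : p != 0 by rewrite gt_eqF// (lt_trans _ p1).
have psi0 : vanishes_off_Gamma psi.
  by move=> z zB muz; rewrite /psi v0// normr0 powR0// mul0r.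
have -> : lambda * \sum_(x in S) `|v x| `^ p = weak_form phi psi.
  apply: oppr_inj; rewrite -weak_formulation// mulr_sumr -sumrN.
  apply: eq_bigr => x xS; have px : 0 < phi x by apply: phi_gt0; rewrite finset.in_setU xS.
  have -> : pLaplacian E S w p phi x = - (lambda * ppow p (phi x)) by rewrite -phi_eig ?opprK.
  by rewrite /psi; field; rewrite ppow_eq0// gt_eqF.
apply: lerD.
  rewrite ler_pM2l ?invr_gt0//; apply: ler_sum => x xC; apply: ler_sum => y yC.
  rewrite /inner_weight; case: ifPn => [xyS|_]; last by rewrite !mulr0.
  rewrite ler_wpM2r// ppow_mul//.
  have flat a b : 0 < phi a -> v b = 0 -> phi b = 0 ->
      ppow p (phi a - phi b) * (psi a - psi b) = `|v a - v b| `^ p.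
    move=> pa vb pb; rewrite /psi vb pb normr0 powR0// mul0r !subr0.
    by rewrite mulrC divfK// ppow_eq0// gt_eqF.
  case: (closure_cases xC) => [px|[xS xB mux]]; case: (closure_cases yC) => [py|[yS yB muy]].
  - exact: picone.
  - by rewrite flat// ?v0// phi_vanish.
  - rewrite -[phi x - phi y]opprB -[psi x - psi y]opprB ppowN mulrNN distrC.
    by rewrite flat// ?v0// phi_vanish.
  - by move: xyS; rewrite (negbTE xS) (negbTE yS).
apply: ler_sum => z zG; have pz : 0 < phi z by apply: phi_gt0; rewrite finset.in_setU zG orbT.
by rewrite ppow_mul// /psi [ppow p (phi z) * _]mulrC divfK// ppow_eq0// gt_eqF.
Qed.

Hypothesis (lambda0 : lambda = 0).

(** Tested against [phi] itself, the eigenvalue problem gives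
    [weak_form phi phi = 0], so every term of the form vanishes.  A boundary
    vertex with [mu z = 0] has [phi z = 0], and its edge to a vertex of [S],
    where [phi] is positive, would contribute; a vertex of [Gamma] with
    [sigma z > 0] would contribute as well. *)
Lemma eigenvalue0_neumann :
  (forall z, z \in vboundary E S -> 0 < mu z) /\
  (forall z, z \in vboundary E S -> sigma z = 0).
Proof.
have p0 : p != 0 by rewrite gt_eqF// (lt_trans _ p1).
have form0 : weak_form phi phi = 0.
  apply: oppr_inj; rewrite -(weak_formulation phi_bnd phi_vanish) oppr0 big1// => x xS.
  have := phi_eig xS; rewrite lambda0 mul0r => /eqP; rewrite oppr_eq0 => /eqP ->.
  by rewrite mulr0.
have d0 : 0 <= dirichlet_form phi phi.
  by apply: dirichlet_form_ge0 => x y; rewrite -expr2 sqr_ge0.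
have r0 : 0 <= robin_form phi phi by apply: robin_form_ge0 => x; rewrite -expr2 sqr_ge0.
have /andP[/eqP dz /eqP rz] : (dirichlet_form phi phi == 0) && (robin_form phi phi == 0).
  by rewrite -paddr_eq0//; apply/eqP.
have mu_gt0 z : z \in vboundary E S -> 0 < mu z.
  move=> zB; rewrite lt_neqAle mu_ge0// andbT eq_sym; apply/eqP => muz.
  have := zB; rewrite inE => /andP[zS /existsP[y /andP[yS Ezy]]].
  have py : 0 < phi y by apply: phi_gt0; rewrite finset.in_setU yS.
  have wzy : 0 < w z y by apply/(weight_edge w_weight).
  move: dz; rewrite /dirichlet_form => /eqP; rewrite mulf_eq0 invr_eq0 pnatr_eq0 /= => /eqP.
  have term_ge0 x x' : 0 <= ppow p (phi x - phi x') * (phi x - phi x') * inner_weight x x'.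
    by rewrite mulr_ge0 ?inner_weight_ge0// ppow_mul// powR_ge0.
  move/psumr_eq0P => /(_ (fun x _ => sumr_ge0 _ (fun x' _ => term_ge0 x x'))) /(_ z).
  rewrite finset.in_setU zB orbT => /(_ isT) /psumr_eq0P => /(_ (fun x' _ => term_ge0 z x')) /(_ y).
  rewrite finset.in_setU yS => /(_ isT) /eqP.
  rewrite ppow_mul// (phi_vanish zB muz) sub0r normrN gtr0_norm// /inner_weight yS orbT.
  by rewrite mulf_eq0 powR_eq0 p0 andbT !gt_eqF.
split => // z zB.
have zG : z \in Gamma_set E S mu by rewrite inE zB mu_gt0.
have pz : 0 < phi z by apply: phi_gt0; rewrite finset.in_setU zG orbT.
have term_ge0 x : x \in Gamma_set E S mu -> 0 <= sigma x / mu x * (ppow p (phi x) * phi x).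
  move=> /Gamma_boundary[xB mux].
  by rewrite mulr_ge0 ?ppow_mul ?powR_ge0// divr_ge0 ?sigma_ge0// ltW.
have := psumr_eq0P term_ge0 rz zG => /eqP.
rewrite ppow_mul// mulf_eq0 powR_eq0 normr_eq0 (gt_eqF pz) /= orbF.
by rewrite mulf_eq0 invr_eq0 (gt_eqF (mu_gt0 z zB)) orbF => /eqP.
Qed.

End Eigenvalue.

(** Under the Neumann condition the constant [1] is a test function with
    vanishing form. *)
Lemma neumann_mass u :
  (forall z, z \in vboundary E S -> 0 < mu z) ->
  (forall z, z \in vboundary E S -> sigma z = 0) ->
  satisfies_boundary u -> \sum_(x in S) pLaplacian E S w p u x = 0.
Proof.
move=> mu0 s0 bu; have off : vanishes_off_Gamma (fun=> 1).
  by move=> z zB muz; have := mu0 z zB; rewrite muz ltxx.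
have := weak_formulation bu off; under eq_bigr do rewrite mul1r.
move=> ->; apply/eqP; rewrite oppr_eq0; apply/eqP.
rewrite /weak_form /dirichlet_form /robin_form big1 ?mulr0 ?add0r; last first.
  by move=> x _; rewrite big1// => y _; rewrite subrr mulr0 mul0r.
by rewrite big1// => z /Gamma_boundary[zB _]; rewrite s0// !mul0r.
Qed.

End Forms.

(** * The nonlinearity *)

Section Nonlinearity.
Context {R : realType}.
Variable f : R -> R.

Lemma loclip_at (a : R) : [locally [lipschitz f s | s in setT]] ->
  exists L r : R, [/\ 0 < L, 0 < r &
    forall x, `|x - a| < r -> `|f x - f a| <= L * `|x - a|].
Proof.
move=> /(_ (a, a) (conj I I)) /pinfty_ex_gt0 [L L0 HL].
have [[A B] [/= /nbhs_ballP[r r0 rA] /nbhs_ballP[r' r0' rB]] AB] := HL.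
exists L, r; split => // x xr.
apply: (AB (x, a)) => //; split => /=.
  by apply: rA; rewrite /ball /= distrC.
by apply: rB; exact: ballxx.
Qed.

Hypotheses (f_loclip : [locally [lipschitz f s | s in setT]]).

Lemma loclip_continuous : continuous f.
Proof.
move=> a; have [L [r [L0 r0 H]]] := loclip_at a f_loclip.
apply/cvgrPdist_le => e e0; near=> x.
have xr : `|x - a| < r.
  by rewrite distrC; near: x; exact: (nbhsx_ballx a r r0).
have xe : `|x - a| < e / L.
  by rewrite distrC; near: x; exact: (nbhsx_ballx a (e / L) (divr_gt0 e0 L0)).
rewrite distrC; apply: le_trans (H x xr) _.
by rewrite mulrC -ler_pdivlMr// ltW.
Unshelve. all: by end_near. Qed.

Lemma continuous_bounded_on (M : R) :
  exists2 K : R, 0 <= K & forall s, `|s| <= M -> `|f s| <= K.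
Proof.
have [M0|M0] := leP 0 M; last first.
  by exists 0 => // s sM; have := le_lt_trans (normr_ge0 s) (le_lt_trans sM M0); rewrite ltxx.
have NM : - M <= M by rewrite (le_trans _ M0)// oppr_le0.
have [|c _ cmax] := @EVT_max R (fun s => `|f s|) (- M) M NM.
  apply: continuous_subspaceT => x; apply: cvg_norm; exact: loclip_continuous.
by exists `|f c| => // s sM; apply: cmax; rewrite in_itv /= -ler_norml.
Qed.

Lemma linear_bound_on (M : R) : f 0 = 0 ->
  exists2 L : R, 0 <= L & forall s, `|s| <= M -> `|f s| <= L * `|s|.
Proof.
move=> f0; have [L [r [L0 r0 H]]] := loclip_at 0 f_loclip.
have [K K0 HK] := continuous_bounded_on M.
exists (L + K / r) => [|s sM]; first by rewrite addr_ge0 ?(ltW L0)// divr_ge0// ltW.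
have [sr|sr] := ltP `|s| r.
  have := H s; rewrite !subr0 f0 subr0 => /(_ sr) /le_trans; apply.
  by rewrite ler_wpM2r// lerDl divr_ge0// ltW.
apply: le_trans (HK s sM) _; apply: (@le_trans _ _ (K / r * `|s|)).
  by rewrite mulrAC ler_pdivlMr// ler_wpM2l.
by rewrite ler_wpM2r// lerDr ltW.
Qed.

(** The derivative of [(F s - gamma / alpha) * s ^ (- alpha)] has the sign of
    [s f s - alpha F s + gamma], so from some [s1] on [F s - gamma / alpha] is at
    least a multiple of [s ^ alpha], and [f s] of [s ^ (alpha - 1)].  Between
    [a] and [s1] the positive continuous [f] has a positive minimum. *)
Lemma power_growth (alpha gamma a : R) : 1 < alpha -> 0 < gamma ->
  (forall s, 0 < s -> 0 < f s) ->
  (forall s, 0 < s -> alpha * primitive0 f s <= s * f s + gamma) ->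
  (exists2 s, 0 < s & gamma < primitive0 f s) -> 0 < a ->
  exists2 c : R, 0 < c & forall s, a <= s -> c * s `^ (alpha - 1) <= f s.
Proof.
move=> al1 g0 f_gt0 growth [s1 s10 Fs1] a0.
have al0 : 0 < alpha by apply: lt_trans al1.
pose H s := (primitive0 f s - gamma / alpha) * s `^ (- alpha).
have dH (s : R) : 0 < s -> is_derive s (1 : R) H
    ((primitive0 f s - gamma / alpha) * (- alpha * s `^ (- alpha - 1))
     + s `^ (- alpha) * (f s - 0)).
  move=> s0; apply: is_deriveM; last exact: is_derive1_powR.
  by apply: is_deriveB; apply: is_derive_primitive0; exact: loclip_continuous.
have H1 : 0 < H s1.
  rewrite mulr_gt0 ?powR_gt0// subr_gt0; apply: lt_trans Fs1.
  by rewrite ltr_pdivrMr// ltr_pMr.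
have Hmono s : s1 <= s -> H s1 <= H s.
  move=> ss; apply: (@ger0_derive1_ndecr R H s1 s) => //.
  - move=> x; rewrite in_itv /= => /andP[sx _].
    by have [] := dH x (lt_trans s10 sx).
  - move=> x; rewrite in_itv /= => /andP[sx _].
    have x0 := lt_trans s10 sx.
    have [_ dE] := dH x x0; rewrite derive1E dE.
    have -> : x `^ (- alpha) = x * x `^ (- alpha - 1).
      rewrite -[X in X * _](powRr1 (ltW x0)) -powRD.
        by congr (_ `^ _); ring.
      by rewrite (gt_eqF x0) implybT.
    rewrite (_ : _ + _ = x `^ (- alpha - 1) * (x * f x + gamma - alpha * primitive0 f x)).
      by rewrite mulr_ge0 ?powR_ge0// subr_ge0 growth.
    by field; rewrite gt_eqF.
  - apply: derivable_within_continuous => x; rewrite in_itv /= => /andP[sx _].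
    by have [] := dH x (lt_le_trans s10 sx).
have far s : s1 <= s -> alpha * H s1 * s `^ (alpha - 1) <= f s.
  move=> ss; have s0 := lt_le_trans s10 ss.
  rewrite -(ler_pM2l s0).
  have -> : s * (alpha * H s1 * s `^ (alpha - 1)) = alpha * H s1 * s `^ alpha.
    by rewrite mulrCA mulr_powRB1// ltW.
  apply: (@le_trans _ _ (alpha * primitive0 f s - gamma)); last by rewrite lerBlDr growth.
  have -> : alpha * primitive0 f s - gamma = alpha * H s * s `^ alpha.
    rewrite /H -!mulrA -powRD; last by rewrite (gt_eqF s0) implybT.
    by rewrite addNr powRr0 mulr1; field; rewrite gt_eqF.
  by rewrite ler_wpM2r ?powR_ge0// ler_pM2l// Hmono.
pose b := Num.min a s1.
have b0 : 0 < b by rewrite lt_min a0.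
have [|q qb qmin] := @EVT_min R f b s1 _ (continuous_subspaceT loclip_continuous).
  by rewrite ge_min lexx orbT.
have fq : 0 < f q.
  by apply: f_gt0; move: qb; rewrite in_itv /= => /andP[bq _]; exact: lt_le_trans bq.
exists (Num.min (alpha * H s1) (f q / s1 `^ (alpha - 1))).
  by rewrite lt_min mulr_gt0//= divr_gt0// powR_gt0.
move=> s as_; have s0 := lt_le_trans a0 as_.
have [ss|ss] := leP s1 s.
  by apply: le_trans (far s ss); rewrite ler_wpM2r ?powR_ge0// ge_min lexx.
apply: (@le_trans _ _ (f q)); last first.
  by apply: qmin; rewrite in_itv /= ge_min as_ /= ltW.
apply: (@le_trans _ _ (f q / s1 `^ (alpha - 1) * s `^ (alpha - 1))).
  by rewrite ler_wpM2r ?powR_ge0// ge_min lexx orbT.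
rewrite mulrAC ler_pdivrMr ?powR_gt0// ler_pM2l//.
by apply: ge0_ler_powR; rewrite ?nnegrE ?ltW// subr_gt0.
Qed.

End Nonlinearity.

Lemma is_derive_min0_sqr (R : realType) (s : R) :
  is_derive s (1 : R) (fun z => Num.min z 0 ^+ 2) (2 * Num.min s 0).
Proof.
have minE : (fun z : R => Num.min z 0 ^+ 2) = (fun z => Num.min z 0 * z).
  apply/funext => z; rewrite expr2; have [z0|z0] := leP z 0 => //.
  by rewrite !mul0r.
have [s0|s0|->] := ltgtP s 0.
- have d2 : is_derive s (1 : R) (fun z : R => z ^+ 2) (2 * s).
    have := is_deriveM (is_derive_id s (1 : R)) (is_derive_id s (1 : R)).
    rewrite (_ : _ + _ = 2 * s); last by rewrite /GRing.scale /=; ring.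
    by apply: near_eq_is_derive; near=> z; rewrite expr2.
  apply: near_eq_is_derive d2; near=> z.
  have /ltW z0 : z < 0 by near: z; exact: lt_nbhsl.
  by rewrite min_l.
- rewrite mulr0; apply: near_eq_is_derive (is_derive_cst 0 s (1 : R)).
  near=> z; have /ltW z0 : 0 < z by near: z; exact: lt_nbhsr.
  by rewrite min_r// expr0n.
- rewrite minE; apply/is_derive1_caratheodory; exists (fun z => Num.min z 0); split.
  + by move=> z; rewrite mulr0 !subr0.
  + apply/cvgrPdist_le => e e0; near=> z; rewrite minxx sub0r normrN.
    apply: (@le_trans _ _ `|z|).
      by have [z0|z0] := leP z 0; rewrite ?normr0.
    have : `|0 - z| < e by near: z; exact: (nbhsx_ballx (0 : R) e e0).
    by rewrite sub0r normrN => /ltW.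
  + by rewrite minxx mulr0.
Unshelve. all: by end_near. Qed.

Lemma cauchy_schwarz_sum (R : realFieldType) (V : finType) (P : pred V) (a b : V -> R) :
  (\sum_(x | P x) a x * b x) ^+ 2 <= (\sum_(x | P x) a x ^+ 2) * (\sum_(x | P x) b x ^+ 2).
Proof.
set A := \sum_(x | P x) a x ^+ 2; set B := \sum_(x | P x) b x ^+ 2.
set C := \sum_(x | P x) a x * b x.
have A0 : 0 <= A by apply: sumr_ge0 => x _; exact: sqr_ge0.
have [A_eq0|A_neq0] := eqVneq A 0.
  have a0 x : P x -> a x = 0.
    move=> Px; have := psumr_eq0P (fun x _ => sqr_ge0 (a x)) A_eq0 Px.
    by move/eqP; rewrite sqrf_eq0 => /eqP.
  by rewrite A_eq0 mul0r /C big1 ?expr0n// => x Px; rewrite a0 ?mul0r.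
have Apos : 0 < A by rewrite lt_neqAle eq_sym A_neq0.
rewrite -subr_ge0 -(pmulr_rge0 _ Apos).
have -> : A * (A * B - C ^+ 2) = \sum_(x | P x) (C * a x - A * b x) ^+ 2.
  transitivity (\sum_(x | P x)
      (C ^+ 2 * a x ^+ 2 - 2 * C * A * (a x * b x) + A ^+ 2 * b x ^+ 2)).
    by rewrite big_split sumrB /= -!mulr_sumr -/A -/B -/C; ring.
  by apply: eq_bigr => x _; ring.
by apply: sumr_ge0 => x _; exact: sqr_ge0.
Qed.

(** * Energy estimates for a solution *)

Section Solution.
Context {R : realType} {V : finType}.
Variables (E : rel V) (S : {set V}) (w : V -> V -> R) (mu sigma : V -> R)
  (p : R) (f : R -> R) (u0 : V -> R) (T : \bar R) (u : V -> R -> R).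
Hypotheses (w_weight : is_weight E w) (p1 : 1 < p)
  (mu_ge0 : forall z, z \in vboundary E S -> 0 <= mu z)
  (sigma_ge0 : forall z, z \in vboundary E S -> 0 <= sigma z)
  (mu_sigma_gt0 : forall z, z \in vboundary E S -> 0 < mu z + sigma z)
  (f_loclip : [locally [lipschitz f s | s in setT]]) (f0 : f 0 = 0)
  (u0_ge0 : forall x, x \in vclosure E S -> 0 <= u0 x)
  (sol : is_solution E S w p mu sigma f u0 T u).

Lemma S_closure x : x \in S -> x \in vclosure E S.
Proof. by move=> xS; rewrite finset.in_setU xS. Qed.

Lemma boundary_closure x : x \in vboundary E S -> x \in vclosure E S.
Proof. by move=> xS; rewrite finset.in_setU xS orbT. Qed.

Let cf : continuous f. Proof. exact: loclip_continuous. Qed.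

Let wform := weak_form E S w p mu sigma.

Definition velocity x t := pLaplacian E S w p (u^~ t) x + f (u x t).

Lemma sol_is_derive x t : x \in vclosure E S -> 0 < t -> (t%:E < T)%E ->
  is_derive t (1 : R) (u x) ('D_1 (u x) t).
Proof. by move=> xC t0 tT; apply: DeriveDef => //; exact: (sol_derivable sol). Qed.

Lemma sol_velocity x t : x \in S -> 0 < t -> (t%:E < T)%E ->
  'D_1 (u x) t = velocity x t.
Proof. by move=> xS t0 tT; rewrite -derive1E (sol_equation sol). Qed.

Lemma sol_satisfies_boundary t : 0 <= t -> (t%:E < T)%E ->
  satisfies_boundary E S w p mu sigma (u^~ t).
Proof. by move=> t0 tT z zB; exact: (sol_boundary sol). Qed.

Lemma sol_vanishes t : 0 <= t -> (t%:E < T)%E -> vanishes_off_Gamma E S mu (u^~ t).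
Proof.
move=> t0 tT z zB muz.
exact: (boundary_dirichlet p1 mu_sigma_gt0 zB muz (sol_boundary sol zB t0 tT)).
Qed.

Lemma sol_cvg x t : x \in vclosure E S -> lifespan T t ->
  u x s @[s --> within (lifespan T) (nbhs t)] --> u x t.
Proof. by move=> xC tT; have /within_continuousP := sol_continuous sol xC; exact. Qed.

Lemma lifespan_near t : 0 < t -> (t%:E < T)%E -> \forall s \near t, 0 < s /\ (s%:E < T)%E.
Proof.
move=> t0 tT; near=> s; split; first by near: s; exact: lt_nbhsr.
near: s; case: (T) tT => [r||//]; last by move=> _; apply: nearW => s; rewrite ltry.
by rewrite lte_fin => tr; near=> s; rewrite lte_fin; near: s; exact: lt_nbhsl.
Unshelve. all: by end_near. Qed.

(** At a boundary vertex with [mu z = 0] the boundary condition keeps [u] at [0]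
    at all times. *)
Lemma velocity_vanishes t : 0 < t -> (t%:E < T)%E ->
  vanishes_off_Gamma E S mu (fun x => 'D_1 (u x) t).
Proof.
move=> t0 tT z zB muz.
have [_ <-] : is_derive t (1 : R) (u z) 0; last by [].
apply: near_eq_is_derive (is_derive_cst 0 t (1 : R)).
near=> s; have [s0 sT] : 0 < s /\ (s%:E < T)%E by near: s; exact: lifespan_near.
by rewrite (sol_vanishes (ltW s0) sT zB muz).
Unshelve. all: by end_near. Qed.

Lemma sol_bounded_on t : lifespan T t ->
  exists M : R, forall x s, x \in S -> 0 <= s <= t -> `|u x s| <= M.
Proof.
move=> [t0 tT].
have H x : x \in S -> exists M : R, forall s, 0 <= s <= t -> `|u x s| <= M.
  move=> xS; have [|c _ cmax] := @EVT_max R (fun s => `|u x s|) 0 t t0.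
    have cu : {within `[0, t], continuous (u x)}.
      apply: continuous_subspaceW (sol_continuous sol (S_closure xS)) => s /=.
      rewrite in_itv /= => /andP[s0 st]; split => //.
      by apply: le_lt_trans tT; rewrite lee_fin.
    by move=> s; apply: cvg_norm; exact: cu.
  by exists `|u x c| => s st; apply: cmax; rewrite in_itv.
pose M x := if pselect (x \in S) is left xS then projT1 (cid (H x xS)) else 0.
have HM x s : x \in S -> 0 <= s <= t -> `|u x s| <= M x.
  rewrite /M; case: pselect => // xS _; exact: (projT2 (cid (H x xS))).
exists (\sum_(x in S) `|M x|) => x s xS st.
apply: le_trans (HM x s xS st) _; apply: le_trans (ler_norm _) _.
by rewrite (bigD1 x)//= lerDl sumr_ge0.
Qed.

(** Test the equation against the negative part [m] of [u].  The form
    [weak_form u m] is nonnegative since [m] is a nondecreasing function of [u],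
    and [|f s| <= L |s|] on the range of [u]; so the sum [N] of the squares of
    [m] satisfies [N' <= 2 L N], and it vanishes at time [0]. *)
Lemma sol_ge0 x t : x \in S -> lifespan T t -> 0 <= u x t.
Proof.
move=> xS tl; have [M HM] := sol_bounded_on tl; have [t0 tT] := tl.
have [L L0 HL] := linear_bound_on f_loclip M f0.
pose m (s : R) := Num.min s 0.
pose N s := \sum_(x in S) m (u x s) ^+ 2.
pose dN s := \sum_(x in S) 2 * m (u x s) * 'D_1 (u x) s.
pose Z s := - (expR (- (2 * L) * s) * N s).
have dNE s : 0 < s -> (s%:E < T)%E -> is_derive s (1 : R) N (dN s).
  move=> s0 sT; apply: is_derive_sumr => y yS.
  have d1 := sol_is_derive (S_closure yS) s0 sT.
  exact: (is_derive1_comp (is_derive_min0_sqr (u y s)) d1).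
have dE s : is_derive s (1 : R) (fun r => expR (- (2 * L) * r))
    (- (2 * L) * expR (- (2 * L) * s)).
  have dl : is_derive s (1 : R) (fun r : R => - (2 * L) * r) (- (2 * L)).
    have := is_deriveZ (- (2 * L)) (is_derive_id s (1 : R)).
    by rewrite [_ *: _]mulr1.
  rewrite [- (2 * L) * expR _]mulrC.
  exact: (is_derive1_comp (is_derive_expR (- (2 * L) * s)) dl).
pose dZf s := - (expR (- (2 * L) * s) * dN s + N s * (- (2 * L) * expR (- (2 * L) * s))).
have dZ s : 0 < s -> (s%:E < T)%E -> is_derive s (1 : R) Z (dZf s).
  by move=> s0 sT; apply: is_deriveN; exact: is_deriveM (dE s) (dNE s s0 sT).
have cZ : {within lifespan T, continuous Z}.
  apply/within_continuousP => s sl; apply: cvgN; apply: cvgM.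
    apply: (@continuous_cvg _ _ _ _ _ _ expR); first exact: continuous_expR.
    by apply: cvgM; [exact: cvg_cst|exact: cvg_within].
  apply: cvg_sumr => y yS.
  apply: (@continuous_cvg _ _ _ _ _ _ (fun z => m z ^+ 2)).
    apply/differentiable_continuous/derivable1_diffP.
    by have [] := is_derive_min0_sqr (u y s).
  by apply: sol_cvg => //; exact: S_closure.
have Z0 : Z 0 = 0.
  rewrite /Z /N big1 ?mulr0 ?oppr0// => y yS.
  have yC := S_closure yS.
  by rewrite /m (sol_initial sol yC) min_r ?expr0n// u0_ge0.
have : Z 0 <= Z t.
  apply: (@ndecr_segment R T Z dZf 0 t cZ (lexx 0) t0 tT) => s /andP[s0 st].
    by apply: dZ => //; apply: lt_trans tT; rewrite lte_fin.
  have sT : (s%:E < T)%E by apply: lt_trans tT; rewrite lte_fin.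
  rewrite (_ : dZf s = expR (- (2 * L) * s) * (2 * L * N s - dN s)); last by rewrite /dZf; ring.
  apply: mulr_ge0; first exact: expR_ge0.
  have -> : dN s = 2 * \sum_(y in S) m (u y s) * pLaplacian E S w p (u^~ s) y
      + 2 * \sum_(y in S) m (u y s) * f (u y s).
    rewrite -mulrDr -big_split mulr_sumr /=; apply: eq_bigr => y yS.
    by rewrite sol_velocity// /velocity; ring.
  have van : vanishes_off_Gamma E S mu (fun y => m (u y s)).
    by move=> z zB muz; rewrite (sol_vanishes (ltW s0) sT zB muz) /m minxx.
  rewrite (weak_formulation w_weight mu_ge0 (sol_satisfies_boundary (ltW s0) sT) van).
  have W0 : 0 <= weak_form E S w p mu sigma (u^~ s) (fun y => m (u y s)).
    apply: weak_form_ge0 => // [y z|y]; rewrite /m.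
      have mono a b : a <= b -> Num.min a 0 <= Num.min b 0 :> R.
        by move=> ab; rewrite le_min !ge_min ab lexx !orbT.
      have [yz|/ltW zy] := leP (u y s) (u z s).
        by rewrite -mulrNN !opprB mulr_ge0// subr_ge0// mono.
      by rewrite mulr_ge0// subr_ge0// mono.
    have [y0|y0] := leP (u y s) 0; first by rewrite -expr2 sqr_ge0.
    by rewrite mulr0.
  have F0 : \sum_(y in S) m (u y s) * f (u y s) <= L * N s.
    rewrite /N mulr_sumr; apply: ler_sum => y yS; rewrite /m.
    have [y0|y0] := leP (u y s) 0; last by rewrite mul0r expr0n mulr0.
    apply: le_trans (ler_norm _) _; rewrite normrM expr2.
    rewrite -[in leRHS](mulrNN (u y s)) -(ler0_norm y0) mulrCA.
    rewrite ler_wpM2l//; apply: HL; apply: HM => //; rewrite (ltW s0) ltW//.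
  lra.
rewrite Z0 /Z oppr_ge0 pmulr_rle0 ?expR_gt0// => Nle.
have N0 : N t = 0.
  by apply/eqP; rewrite eq_le Nle sumr_ge0// => y _; exact: sqr_ge0.
have := psumr_eq0P (fun y _ => sqr_ge0 (m (u y t))) N0 xS.
move/eqP; rewrite sqrf_eq0 /m => /eqP H.
rewrite leNgt; apply/negP => ux; move: H; rewrite min_l ?ltW// => H.
by move: ux; rewrite H ltxx.
Qed.

Variable gamma : R.

Definition energy t :=
  \sum_(x in S) (primitive0 f (u x t) - gamma) - p^-1 * wform (u^~ t) (u^~ t).

Definition mass2 t := \sum_(x in S) u x t ^+ 2.

Lemma continuous_primitive0 : continuous (primitive0 f).
Proof.
move=> s; apply/differentiable_continuous/derivable1_diffP.
by have [] := is_derive_primitive0 s cf.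
Qed.

Lemma within_energy : {within lifespan T, continuous energy}.
Proof.
apply/within_continuousP => t tl; apply: cvgB.
  apply: cvg_sumr => x xS; apply: cvgB; last exact: cvg_cst.
  apply: (@continuous_cvg _ _ _ _ _ _ (primitive0 f)); first exact: continuous_primitive0.
  exact: sol_cvg (S_closure xS) tl.
apply: cvgM; first exact: cvg_cst.
by apply: cvg_weak_form => // x xC; exact: sol_cvg.
Qed.

Lemma within_mass2 : {within lifespan T, continuous mass2}.
Proof.
apply/within_continuousP => t tl; apply: cvg_sumr => x xS.
rewrite expr2; under eq_cvg do rewrite expr2.
by apply: cvgM; apply: sol_cvg (S_closure xS) tl.
Qed.

Lemma is_derive_mass2 t : 0 < t -> (t%:E < T)%E ->
  is_derive t (1 : R) mass2 (2 * \sum_(x in S) u x t * 'D_1 (u x) t).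
Proof.
move=> t0 tT; rewrite mulr_sumr; apply: is_derive_sumr => x xS.
have d1 := sol_is_derive (S_closure xS) t0 tT.
have := is_deriveM d1 d1.
rewrite (_ : _ + _ = 2 * (u x t * 'D_1 (u x) t)); last by rewrite /GRing.scale /=; ring.
by apply: near_eq_is_derive; near=> s; rewrite expr2.
Unshelve. all: by end_near. Qed.

(** The energy is the potential of the flow: by the weak formulation tested
    against [u_t], its derivative is [sum_S u_t (Delta u + f u)]. *)
Lemma is_derive_energy t : 0 < t -> (t%:E < T)%E ->
  is_derive t (1 : R) energy (\sum_(x in S) ('D_1 (u x) t) ^+ 2).
Proof.
move=> t0 tT.
have -> : \sum_(x in S) ('D_1 (u x) t) ^+ 2 =
    \sum_(x in S) (f (u x t) * 'D_1 (u x) t - 0)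
    - p^-1 * (p * wform (u^~ t) (fun x => 'D_1 (u x) t)).
  rewrite mulKf; last by rewrite gt_eqF// (lt_trans _ p1).
  rewrite -(weak_formulation w_weight mu_ge0 (sol_satisfies_boundary (ltW t0) tT)
    (velocity_vanishes t0 tT)) -big_split /=; apply: eq_bigr => x xS.
  by rewrite (sol_velocity xS t0 tT) /velocity; ring.
apply: is_deriveB.
  apply: is_derive_sumr => x xS; apply: is_deriveB.
  exact: (is_derive1_comp (is_derive_primitive0 _ cf) (sol_is_derive (S_closure xS) t0 tT)).
apply: is_derive_mull; apply: is_derive_weak_form => // x xC.
exact: sol_is_derive.
Qed.

Lemma mass2_rate t : 0 < t -> (t%:E < T)%E ->
  \sum_(x in S) u x t * 'D_1 (u x) t =
  - wform (u^~ t) (u^~ t) + \sum_(x in S) u x t * f (u x t).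
Proof.
move=> t0 tT.
rewrite -(weak_formulation w_weight mu_ge0 (sol_satisfies_boundary (ltW t0) tT)
  (sol_vanishes (ltW t0) tT)) -big_split /=.
by apply: eq_bigr => x xS; rewrite (sol_velocity xS t0 tT) /velocity; ring.
Qed.

Variables (lambda alpha beta : R).
Hypotheses (lambda_first : is_first_eigenvalue E S w p mu sigma lambda)
  (f_gt0 : forall s, 0 < s -> 0 < f s) (alpha_gt2 : 2 < alpha) (gamma_gt0 : 0 < gamma)
  (beta_bounds : 0 <= beta <= (alpha - p) * lambda / p)
  (f_growth : forall s, 0 < s ->
      alpha * primitive0 f s <= s * f s + beta * s `^ p + gamma)
  (u0_energy :
      0 < - (1 / (2 * p)) *
            (\sum_(x in vclosure E S) \sum_(y in vclosure E S)
               `|u0 x - u0 y| `^ p * w x y)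
          - 1 / p *
            (\sum_(z in Gamma_set E S mu) sigma z / mu z * `|u0 z| `^ p)
          + \sum_(x in S) (primitive0 f (u0 x) - gamma)).

Let p0 : 0 < p. Proof. exact: lt_trans p1. Qed.

Let lifespan0 : lifespan T 0.
Proof. by split => //; exact: (sol_time_gt0 sol). Qed.

Lemma weak_form_diag_ge0 v : 0 <= wform v v.
Proof. by apply: weak_form_ge0 => // *; rewrite -expr2 sqr_ge0. Qed.

Lemma energy0_gt0 : 0 < energy 0.
Proof.
apply: lt_le_trans u0_energy _.
rewrite /energy /wform weak_form_diag//.
have -> : \sum_(x in S) (primitive0 f (u x 0) - gamma)
    = \sum_(x in S) (primitive0 f (u0 x) - gamma).
  by apply: eq_bigr => x xS; rewrite (sol_initial sol) ?S_closure.
have -> : \sum_(z in Gamma_set E S mu) sigma z / mu z * `|u z 0| `^ p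
    = \sum_(z in Gamma_set E S mu) sigma z / mu z * `|u0 z| `^ p.
  by apply: eq_bigr => z /Gamma_boundary[zB _]; rewrite (sol_initial sol) ?boundary_closure.
have : \sum_(x in vclosure E S) \sum_(y in vclosure E S)
      `|u x 0 - u y 0| `^ p * inner_weight S w x y
    <= \sum_(x in vclosure E S) \sum_(y in vclosure E S) `|u0 x - u0 y| `^ p * w x y.
  apply: ler_sum => x xC; apply: ler_sum => y yC.
  by rewrite !(sol_initial sol)// ler_wpM2l ?powR_ge0// (inner_weight_le _ w_weight).
set A := \sum_(x in _) _; set B := \sum_(x in _) _; set C := \sum_(z in _) _.
set D := \sum_(x in S) _ => AB.
have -> : D - p^-1 * (2^-1 * A + C) = - (1 / (2 * p)) * A - 1 / p * C + D.
  by field; rewrite gt_eqF.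
by rewrite !lerD2r !mulNr lerN2 ler_wpM2l// divr_ge0// mulr_ge0// ltW.
Qed.

Lemma exists_primitive_gt : exists2 x, x \in S & gamma < primitive0 f (u x 0).
Proof.
apply: contrapT => H; have := energy0_gt0; rewrite ltNge => /negP; apply.
rewrite /energy subr_le0; apply: (@le_trans _ _ 0); last first.
  by rewrite mulr_ge0 ?weak_form_diag_ge0// invr_ge0 ltW.
apply: sumr_le0 => x xS; rewrite subr_le0 leNgt; apply/negP => Hx.
by apply: H; exists x.
Qed.

Lemma initial_gt0 x : x \in S -> gamma < primitive0 f (u x 0) -> 0 < u x 0.
Proof.
move=> xS Hx; rewrite lt_neqAle (sol_ge0 xS lifespan0) andbT; apply/eqP => ux0.
by move: Hx; rewrite -ux0 primitive00 => /(lt_trans gamma_gt0); rewrite ltxx.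
Qed.

(** The two bounds relating [Y] to the solution serve opposite purposes: the
    first carries the blow-up of [Y] over to [sum_S u ^ 2], the second bounds the
    solution on [S] as long as [Y] is bounded. *)
Lemma growth_functional : exists (Y dY : R -> R) (c e K : R),
  [/\ 0 < c, 0 < e, {within lifespan T, continuous Y},
      forall t, 0 < t -> (t%:E < T)%E -> is_derive t (1 : R) Y (dY t) & 0 < Y 0] /\
  [/\ forall t, 0 < t -> (t%:E < T)%E -> c * Y t `^ (1 + e) <= dY t,
      forall t, lifespan T t -> Y t <= mass2 t + K
    & forall t x, lifespan T t -> x \in S -> `|u x t| <= Y t + 1].
Proof.
have [x0 x0S Fx0] := exists_primitive_gt.
have ux0 := initial_gt0 x0S Fx0.
have [lambda_ge0 [phi [phi_gt0 phi_eig phi_bnd]]] := lambda_first.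
have alpha_gt0 : 0 < alpha by apply: lt_trans alpha_gt2.
have [pa|ap] := leP p alpha.
  have mass0 : 0 < mass2 0.
    apply: (@lt_le_trans _ _ (u x0 0 ^+ 2)); first by rewrite exprn_gt0.
    by rewrite /mass2 (bigD1 x0)//= lerDl sumr_ge0// => x _; exact: sqr_ge0.
  have [|||c c0 Hc] := @levine_concavity R T mass2
    (fun t => 2 * \sum_(x in S) u x t * 'D_1 (u x) t) energy
    (fun t => \sum_(x in S) ('D_1 (u x) t) ^+ 2) alpha alpha_gt2 (sol_time_gt0 sol)
    within_mass2 within_energy is_derive_mass2 is_derive_energy mass0 energy0_gt0.
  - by move=> t _ _; apply: sumr_ge0 => x _; exact: sqr_ge0.
  - move=> t t0 tT; rewrite -mulrA ler_pM2l// mass2_rate//.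
    have tl : lifespan T t by split => //; exact: ltW.
    set W := wform _ _.
    have eigW : lambda * \sum_(x in S) `|u x t| `^ p <= W.
      by apply: (eigenvalue_le _ _ _ _ phi_gt0) => //; exact: sol_vanishes (ltW t0) tT.
    have react : \sum_(x in S) (alpha * primitive0 f (u x t) - beta * `|u x t| `^ p - gamma)
        <= \sum_(x in S) u x t * f (u x t).
      apply: ler_sum => x xS; have := sol_ge0 xS tl; rewrite le_eqVlt => /predU1P[<-|ux].
        by rewrite primitive00 normr0 powR0 ?gt_eqF// f0 !mulr0 subr0 sub0r oppr_le0 ltW.
      by rewrite gtr0_norm//; have := f_growth ux; lra.
    have {react} react : alpha * \sum_(x in S) primitive0 f (u x t)
        - beta * \sum_(x in S) `|u x t| `^ p - \sum_(x in S) gamma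
        <= \sum_(x in S) u x t * f (u x t).
      by apply: le_trans react; rewrite !sumrB !mulr_sumr.
    have G0 : 0 <= \sum_(x in S) gamma by apply: sumr_ge0 => x _; exact: ltW.
    have P0 : 0 <= \sum_(x in S) `|u x t| `^ p by apply: sumr_ge0 => x _; exact: powR_ge0.
    have eE : energy t = \sum_(x in S) primitive0 f (u x t) - \sum_(x in S) gamma - p^-1 * W.
      by rewrite /energy sumrB.
    rewrite eE; move: react eigW G0 P0.
    set A := \sum_(x in S) primitive0 f _; set B := \sum_(x in S) `|_| `^ p.
    set G := \sum_(x in S) gamma; set H := \sum_(x in S) _ * f _ => react eigW G0 P0.
    have betaB : beta * B <= (alpha - p) / p * W.
      apply: (@le_trans _ _ ((alpha - p) * lambda / p * B)).
        by rewrite ler_wpM2r//; case/andP: beta_bounds.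
      have -> : (alpha - p) * lambda / p * B = (alpha - p) / p * (lambda * B) by ring.
      by rewrite ler_wpM2l// divr_ge0 ?subr_ge0// ltW.
    have eW : (alpha - p) / p * W = alpha * (p^-1 * W) - W by field; rewrite gt_eqF.
    have aG : G <= alpha * G by rewrite ler_peMl//; apply/ltW/(lt_trans _ alpha_gt2); rewrite ltr1n.
    rewrite eW in betaB; rewrite !mulrBr; lra.
  - move=> t t0 tT; rewrite exprMn (_ : 2 ^+ 2 = 4 :> R); last by rewrite -natrX.
    by rewrite -mulrA ler_pM2l// cauchy_schwarz_sum.
  exists mass2, (fun t => 2 * \sum_(x in S) u x t * 'D_1 (u x) t), c, (alpha / 2 - 1), 0.
  split; split => //.
  - by rewrite subr_gt0 ltr_pdivlMr// mul1r.
  - exact: within_mass2.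
  - exact: is_derive_mass2.
  - by move=> t _; rewrite addr0.
  - move=> t x _ xS; apply: (@le_trans _ _ (u x t ^+ 2 + 1)).
      rewrite -real_normK ?num_real//; have := sqr_ge0 (`|u x t| - 2^-1); rewrite sqrrB; lra.
    by rewrite lerD2r /mass2 (bigD1 x)//= lerDl sumr_ge0// => y _; exact: sqr_ge0.
(* If alpha < p, then lambda = beta = 0: the p-Laplacian has zero sum over S
   and the total mass m is driven by f alone. *)
have lam0 : lambda = 0.
  have /andP[b1 b2] := beta_bounds; apply/eqP; rewrite eq_le lambda_ge0 andbT.
  have := le_trans b1 b2; rewrite pmulr_lge0 ?invr_gt0// nmulr_rge0// subr_lt0//.
have beta0 : beta = 0.
  by have := beta_bounds; rewrite lam0 mulr0 mul0r -eq_le eq_sym => /eqP.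
have [mu_gt0 sigma0] := eigenvalue0_neumann w_weight p1 mu_ge0 sigma_ge0 mu_sigma_gt0
  phi_gt0 phi_eig phi_bnd lam0.
pose m t := \sum_(x in S) u x t.
pose dm t := \sum_(x in S) 'D_1 (u x) t.
have dmE t : 0 < t -> (t%:E < T)%E -> is_derive t (1 : R) m (dm t).
  by move=> t0 tT; apply: is_derive_sumr => x xS; exact: sol_is_derive (S_closure xS) t0 tT.
have dm_react t : 0 < t -> (t%:E < T)%E -> dm t = \sum_(x in S) f (u x t).
  move=> t0 tT; rewrite /dm (eq_bigr (fun x => velocity x t)); last first.
    by move=> x xS; rewrite sol_velocity.
  rewrite big_split /= (neumann_mass w_weight mu_ge0 mu_gt0 sigma0) ?add0r//.
  exact: sol_satisfies_boundary (ltW t0) tT.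
have fu_ge0 x t : x \in S -> lifespan T t -> 0 <= f (u x t).
  move=> xS tl; have := sol_ge0 xS tl; rewrite le_eqVlt => /predU1P[<-|ux]; first by rewrite f0.
  exact/ltW/f_gt0.
have cm : {within lifespan T, continuous m}.
  apply/within_continuousP => t tl; apply: cvg_sumr => x xS.
  exact: sol_cvg (S_closure xS) tl.
have m_ge t x : lifespan T t -> x \in S -> u x t <= m t.
  move=> tl xS; rewrite /m (bigD1 x)//= lerDl sumr_ge0// => y /andP[yS _].
  exact: sol_ge0.
have m0 : 0 < m 0 by apply: lt_le_trans ux0 _; exact: m_ge.
have m_mono t : lifespan T t -> m 0 <= m t.
  move=> [t0 tT]; apply: (@ndecr_lifespan R T m dm cm dmE _ 0 t (lexx 0) t0 tT) => s s0 sT.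
  by rewrite dm_react// sumr_ge0// => x xS; apply: fu_ge0 => //; split => //; exact: ltW.
pose n : R := #|S|%:R.
have n0 : 0 < n by rewrite ltr0n; apply/card_gt0P; exists x0.
have [|||c c0 Hc] := @power_growth R f f_loclip alpha gamma (m 0 / n) _
  gamma_gt0 f_gt0 _ _ (divr_gt0 m0 n0).
- by apply: lt_trans alpha_gt2; rewrite ltr1n.
- by move=> s s0; have := f_growth s0; rewrite beta0 mul0r addr0.
- by exists (u x0 0).
have a1 : 0 < alpha - 1 by rewrite subr_gt0; apply: lt_trans alpha_gt2; rewrite ltr1n.
exists m, dm, (c * n `^ (- (alpha - 1))), (alpha - 2), n.
split; split => //.
- by rewrite mulr_gt0// powR_gt0.
- by rewrite subr_gt0.
- move=> t t0 tT; have tl : lifespan T t by split => //; exact: ltW.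
  have [x xS xm] : exists2 x, x \in S & m t / n <= u x t.
    apply: contrapT => H; have : m t < m t.
      have {2}-> : m t = \sum_(x in S) (m t / n).
        by rewrite sumr_const -mulr_natr divfK// gt_eqF.
      have small x : x \in S -> u x t < m t / n.
        by move=> xS; rewrite ltNge; apply/negP => Hx; apply: H; exists x.
      rewrite [ltLHS](bigD1 x0)//= [ltRHS](bigD1 x0)//=; apply: ltr_leD; first exact: small.
      by apply: ler_sum => x /andP[xS _]; apply/ltW/small.
    by rewrite ltxx.
  have mt0 : 0 <= m t by apply: le_trans (m_mono t tl); exact: ltW.
  have -> : c * n `^ (- (alpha - 1)) * m t `^ (1 + (alpha - 2)) = c * (m t / n) `^ (alpha - 1).
    rewrite powRM ?invr_ge0 ?(ltW n0)// -powR_inv1 ?(ltW n0)// -powRrM mulN1r.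
    by rewrite (_ : 1 + (alpha - 2) = alpha - 1); ring.
  rewrite dm_react//; apply: (@le_trans _ _ (f (u x t))).
    apply: (@le_trans _ _ (c * u x t `^ (alpha - 1))).
      rewrite ler_pM2l//; apply: ge0_ler_powR; rewrite ?nnegrE ?(ltW a1)//.
      + by rewrite divr_ge0// ltW.
      + exact: sol_ge0.
    apply: Hc; apply: le_trans xm; rewrite ler_pM2r ?invr_gt0//; exact: m_mono.
  by rewrite (bigD1 x)//= lerDl sumr_ge0// => y /andP[yS _]; exact: fu_ge0.
- move=> t tl; rewrite /m /mass2 /n -sum1_card natr_sum -big_split /=.
  apply: ler_sum => x xS; have := sqr_ge0 (u x t - 2^-1); rewrite sqrrB; lra.
- move=> t x tl xS; rewrite ger0_norm ?sol_ge0//.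
  by apply: le_trans (m_ge t x tl xS) _; rewrite lerDl.
Qed.

End Solution.

(** * Elimination of the boundary values *)

Section Extend.
Context {R : realType} {V : finType}.
Variables (E : rel V) (S : {set V}) (w : V -> V -> R) (mu sigma : V -> R) (p : R).
Hypotheses (w_weight : is_weight E w) (p1 : 1 < p)
  (mu_ge0 : forall z, z \in vboundary E S -> 0 <= mu z)
  (sigma_ge0 : forall z, z \in vboundary E S -> 0 <= sigma z)
  (mu_sigma_gt0 : forall z, z \in vboundary E S -> 0 < mu z + sigma z).
Implicit Types U : V -> R.

(** The boundary condition at [z] balances the values of the neighbours of [z]
    in [S], with weights [mu z * w x z], and the value [0], with weight
    [sigma z].  The index [z] itself, which lies outside [S], stands for the
    latter. *)
Definition boundary_weights z x : R :=
  if x \in S then mu z * w x z else if x == z then sigma z else 0.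

Definition boundary_data U x : R := if x \in S then U x else 0.

Definition extend U y : R :=
  if y \in S then U y else pmean p (boundary_weights y) (boundary_data U).

Lemma extend_in U x : x \in S -> extend U x = U x.
Proof. by rewrite /extend => ->. Qed.

Let boundary_notin z : z \in vboundary E S -> z \notin S.
Proof. by rewrite inE => /andP[]. Qed.

Lemma boundary_weights_ge0 z x : z \in vboundary E S -> 0 <= boundary_weights z x.
Proof.
move=> zB; rewrite /boundary_weights; case: ifP => _.
  by rewrite mulr_ge0 ?mu_ge0// (weight_ge0 w_weight).
by case: ifP => // _; exact: sigma_ge0.
Qed.

Lemma boundary_weights_gt0 z : z \in vboundary E S ->
  exists x, 0 < boundary_weights z x.
Proof.
move=> zB; have zS := boundary_notin zB.
have := mu_ge0 zB; rewrite le_eqVlt => /predU1P[muz|muz].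
  exists z; rewrite /boundary_weights (negbTE zS) eqxx.
  by have := mu_sigma_gt0 zB; rewrite -muz add0r.
have := zB; rewrite inE => /andP[_ /existsP[y /andP[yS Ezy]]].
exists y; rewrite /boundary_weights yS mulr_gt0//.
by rewrite (weight_sym w_weight); apply/(weight_edge w_weight).
Qed.

Lemma pbalance_boundary U z : z \in vboundary E S ->
  pbalance p (boundary_weights z) (boundary_data U) (U z)
  = boundary_op S w p mu sigma U z.
Proof.
move=> zB; have zS := boundary_notin zB.
rewrite /pbalance (bigID (mem S))/=; congr (_ + _).
  rewrite /pnormal mulr_sumr; apply: eq_bigr => x xS.
  by rewrite /boundary_weights /boundary_data xS; ring.
rewrite (bigD1 z)//= big1 ?addr0.
  by rewrite /boundary_weights /boundary_data (negbTE zS) eqxx subr0.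
by move=> x /andP[xS xz]; rewrite /boundary_weights (negbTE xS) (negbTE xz) mul0r.
Qed.

Lemma boundary_data_extend U : boundary_data (extend U) = boundary_data U.
Proof.
by apply/funext => x; rewrite /boundary_data; case: ifP => // xS; rewrite extend_in.
Qed.

Lemma pbalance_extend U z : z \in vboundary E S ->
  pbalance p (boundary_weights z) (boundary_data U) (extend U z) = 0.
Proof.
move=> zB; rewrite /extend (negbTE (boundary_notin zB)); apply: pmeanP => // x.
exact: boundary_weights_ge0.
Qed.

Lemma extend_boundary U : satisfies_boundary E S w p mu sigma (extend U).
Proof.
by move=> z zB; rewrite -pbalance_boundary// boundary_data_extend pbalance_extend.
Qed.

Lemma extend_id U y : satisfies_boundary E S w p mu sigma U ->
  y \in vclosure E S -> extend U y = U y.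
Proof.
move=> bU; rewrite finset.in_setU => /orP[/extend_in//|yB].
have c0 x : 0 <= boundary_weights y x by exact: boundary_weights_ge0.
apply: (pbalance_uniq p1 c0 (boundary_weights_gt0 yB) (pbalance_extend U yB)).
by rewrite pbalance_boundary// bU.
Qed.

Lemma extend_norm U M y : y \in vclosure E S -> 0 <= M ->
  (forall x, x \in S -> `|U x| <= M) -> `|extend U y| <= M.
Proof.
rewrite finset.in_setU => /orP[yS|yB] M0 UM; first by rewrite extend_in// UM.
rewrite /extend (negbTE (boundary_notin yB)); apply: pmean_norm => //.
- by move=> x; exact: boundary_weights_ge0.
- exact: boundary_weights_gt0.
- by move=> x; rewrite /boundary_data; case: ifP => [/UM//|_]; rewrite normr0.
Qed.

Lemma cvg_extend T (F : set_system T) (FF : Filter F) (U : V -> T -> R) (a : V -> R) y :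
  y \in vclosure E S -> (forall x, x \in S -> U x s @[s --> F] --> a x) ->
  extend (U^~ s) y @[s --> F] --> extend a y.
Proof.
rewrite finset.in_setU => /orP[yS|yB] Ua.
  by under eq_cvg do rewrite extend_in//; rewrite extend_in//; exact: Ua.
rewrite /extend (negbTE (boundary_notin yB)).
apply: (@cvg_pmean _ _ p _ p1 _ _ _ F FF (fun x s => boundary_data (U^~ s) x)
  (boundary_data a)).
- by move=> x; exact: boundary_weights_ge0.
- exact: boundary_weights_gt0.
- by move=> x; rewrite /boundary_data; case: ifP => [/Ua//|_]; exact: cvg_cst.
Qed.

Lemma derivable_extend (U : V -> R -> R) (t : R) y : y \in vclosure E S ->
  (forall x, x \in S -> derivable (U x) t 1) ->
  derivable (fun s => extend (U^~ s) y) t 1.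
Proof.
rewrite finset.in_setU => /orP[yS|yB] dU.
  have -> : (fun s => extend (U^~ s) y) = U y; last exact: dU.
  by apply/funext => s; rewrite extend_in.
apply: (@derivable_pbalance _ _ p (boundary_weights y) (fun x s => boundary_data (U^~ s) x)) => //.
- by move=> x; exact: boundary_weights_ge0.
- exact: boundary_weights_gt0.
- by move=> s; exact: pbalance_extend.
- move=> x; rewrite /boundary_data; have [xS|xS] := boolP (x \in S); first exact: dU.
  by have [] := is_derive_cst (0 : R) t (1 : R).
Qed.

Variable f : R -> R.
Hypothesis (cf : continuous f).

Definition vector_field U x : R :=
  if x \in S then pLaplacian E S w p (extend U) x + f (U x) else 0.

Lemma cvg_vector_field T (F : set_system T) (FF : Filter F) (U : V -> T -> R) (a : V -> R) x :
  (forall x, x \in S -> U x s @[s --> F] --> a x) ->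
  vector_field (U^~ s) x @[s --> F] --> vector_field a x.
Proof.
move=> Ua; rewrite /vector_field; case: ifP => xS; last exact: cvg_cst.
apply: cvgD; last first.
  by apply: (@continuous_cvg _ _ _ _ _ _ f); [exact: cf|exact: Ua].
apply: cvg_sumr => y yC; apply: cvgM; last exact: cvg_cst.
apply: (@continuous_cvg _ _ _ _ _ _ (ppow p)); first exact: continuous_ppow.
by apply: cvgB; apply: cvg_extend => //; rewrite finset.in_setU xS.
Qed.

(** Continuity along arbitrary filters, applied to the filter of boxes. *)
Lemma vector_field_continuous : sup_continuous vector_field.
Proof.
move=> U e e0.
pose box := filter_from [set n : R | 0 < n]
  (fun n => [set W : V -> R | forall y, `|W y - U y| < n]).
have Fbox : Filter box.
  apply: filter_from_filter; first by exists 1; rewrite /=.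
  move=> i j /= i0 j0; exists (Num.min i j); first by rewrite /= lt_min i0.
  by move=> W /= H; split => y; have := H y; rewrite lt_min => /andP[].
have coord x : W x @[W --> box] --> U x.
  apply/cvgrPdist_lt => d d0; exists d => //= W /(_ x).
  by rewrite distrC.
have : \forall W \near box, forall x, `|vector_field U x - vector_field W x| < e.
  apply: filter_forall => x.
  have /cvgrPdist_lt := @cvg_vector_field _ box Fbox (fun x W => W x) U x (fun y _ => coord y).
  exact.
by move=> [n /= n0 H]; exists n => // W /H Wx x; rewrite distrC.
Qed.

Lemma pLaplacian_ext U U' x : x \in S ->
  (forall y, y \in vclosure E S -> U y = U' y) ->
  pLaplacian E S w p U x = pLaplacian E S w p U' x.
Proof.
move=> xS H; apply: eq_bigr => y yC; rewrite !H//.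
by rewrite finset.in_setU xS.
Qed.

Lemma vector_field_bounded M : 0 <= M ->
  (exists2 K : R, 0 <= K & forall s, `|s| <= M -> `|f s| <= K) ->
  exists2 K : R, 0 <= K & forall U, (forall x, x \in S -> `|U x| <= M) ->
    forall x, `|vector_field U x| <= K.
Proof.
move=> M0 [Kf Kf0 HK].
pose L := \sum_x \sum_(y in vclosure E S) (M + M) `^ (p - 1) * w x y.
have w0 := weight_ge0 w_weight.
have L0 x : 0 <= \sum_(y in vclosure E S) (M + M) `^ (p - 1) * w x y.
  by apply: sumr_ge0 => y _; rewrite mulr_ge0 ?powR_ge0.
have LL : 0 <= L by apply: sumr_ge0.
exists (L + Kf) => [|U UM x]; first exact: addr_ge0.
rewrite /vector_field; case: ifPn => [xS|_]; last by rewrite normr0 addr_ge0.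
apply: le_trans (ler_normD _ _) _; apply: lerD; last by apply: HK; exact: UM.
apply: (@le_trans _ _ (\sum_(y in vclosure E S) (M + M) `^ (p - 1) * w x y)); last first.
  by rewrite [leRHS](bigD1 x)//= lerDl sumr_ge0.
apply: le_trans (ler_norm_sum _ _ _) _; apply: ler_sum => y yC.
rewrite normrM (ger0_norm (w0 _ _)) ler_wpM2r// norm_ppow//.
apply: ge0_ler_powR; rewrite ?nnegrE ?subr_ge0 ?addr_ge0 ?(ltW p1)//.
apply: le_trans (ler_normB _ _) _; apply: lerD; apply: extend_norm => //.
by rewrite finset.in_setU xS.
Qed.

End Extend.

(** * Continuation of bounded solutions *)

Section Continuation.
Context {R : realType} {V : finType}.
Variables (E : rel V) (S : {set V}) (w : V -> V -> R) (mu sigma : V -> R)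
  (p : R) (f : R -> R) (u0 : V -> R) (T : R) (u : V -> R -> R).
Hypotheses (w_weight : is_weight E w) (p1 : 1 < p)
  (mu_ge0 : forall z, z \in vboundary E S -> 0 <= mu z)
  (sigma_ge0 : forall z, z \in vboundary E S -> 0 <= sigma z)
  (mu_sigma_gt0 : forall z, z \in vboundary E S -> 0 < mu z + sigma z)
  (f_loclip : [locally [lipschitz f s | s in setT]])
  (sol : is_solution E S w p mu sigma f u0 T%:E u).

Let cf : continuous f. Proof. exact: loclip_continuous. Qed.

Let G := vector_field E S w mu sigma p f.
Let ext := extend S w mu sigma p.

Lemma sol_vector_field t x : x \in S -> 0 < t -> t < T ->
  is_derive t (1 : R) (u x) (G (u^~ t) x).
Proof.
move=> xS t0 tT; have tT' : (t%:E < T%:E)%E by rewrite lte_fin.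
have xC := S_closure E xS.
have := sol_is_derive sol xC t0 tT'.
rewrite (sol_velocity sol xS t0 tT') /velocity /G /vector_field xS.
rewrite (@pLaplacian_ext R V E S w p (ext (u^~ t)) (u^~ t) x xS)// => y yC.
have bt := sol_satisfies_boundary sol (ltW t0) tT'.
exact: (extend_id w_weight p1 mu_ge0 sigma_ge0 mu_sigma_gt0 bt yC).
Qed.

Variable M : R.
Hypothesis (u_bounded : forall x t, x \in S -> 0 <= t -> t < T -> `|u x t| <= M).

Let T0 : 0 < T. Proof. by have := sol_time_gt0 sol; rewrite lte_fin. Qed.

(** The velocity of a bounded solution is bounded, so [u] is Lipschitz and has a
    limit [a] at [T].  By continuity of the vector field the velocity tends to
    [G a], so [u], continued by [a], has left derivative [G a] at [T]. *)
Lemma endpoint_slope : exists a : V -> R,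
  forall (e : R), 0 < e -> exists2 n : R, 0 < n & forall x t, x \in S -> 0 <= t ->
    T - n < t -> t < T -> `|u x t - a x - G a x * (t - T)| <= e * `|t - T|.
Proof.
have [/card_gt0P[x0 x0S]|] := boolP (0 < #|S|)%N; last first.
  rewrite -eqn0Ngt cards_eq0 => /eqP S0; exists (fun=> 0) => e e0.
  by exists 1 => // x t; rewrite S0 finset.in_set0.
have M0 : 0 <= M by apply: le_trans (u_bounded x0S (lexx 0) T0).
have [K K0 HK] := vector_field_bounded w_weight p1 mu_ge0 sigma_ge0 mu_sigma_gt0 M0
  (continuous_bounded_on f_loclip M).
have secant c e x s t : x \in S -> 0 <= s -> s <= t -> t < T ->
    (forall r, s < r < t -> `|G (u^~ r) x - c| <= e) ->
    `|u x t - u x s - c * (t - s)| <= e * (t - s).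
  move=> xS s0 st tT; apply: (@secant_bound R T%:E (u x) (fun r => G (u^~ r) x)) => //.
  - exact: (sol_continuous sol (S_closure E xS)).
  - by move=> r /andP[sr rt]; apply: sol_vector_field => //; lra.
have lip x s t : x \in S -> 0 <= s -> s <= t -> t < T -> `|u x t - u x s| <= K * (t - s).
  move=> xS s0 st tT; have := @secant 0 K x s t xS s0 st tT.
  rewrite mul0r subr0; apply => r /andP[sr rt]; rewrite subr0; apply: HK => y yS.
  by apply: u_bounded => //; lra.
have near_left s : s < T -> \forall t \near T^'-, s <= t /\ t < T.
  move=> sT; near=> t; split; first by near: t; exact: nbhs_left_ge.
  by near: t; exact: nbhs_left_lt.
have PFT : ProperFilter T^'- by exact: at_left_proper_filter.
have [F [UF sF]] := ultraFilterLemma PFT.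
have lim x : x \in S -> exists l : R, u x t @[t --> F] --> l.
  move=> xS; apply: (@ultra_bounded_cvg _ _ F UF (u x) M).
  have H : \forall t \near T^'-, `|u x t| <= M.
    by apply: filterS (near_left 0 T0) => t [t0 tT]; exact: u_bounded.
  exact: sF.
pose a x : R := xget 0 [set l | u x t @[t --> F] --> l].
have aP x : x \in S -> u x t @[t --> F] --> a x.
  by move=> /lim H; exact: (@xgetPex _ 0 [set l : R | u x t @[t --> F] --> l] H).
have pass (g : R -> R) (l b s : R) : s < T -> g t @[t --> F] --> l ->
    (forall t, s <= t -> t < T -> g t <= b) -> l <= b.
  move=> sT gl Hg; apply: (cvgr_to_le gl).
  have H : \forall t \near T^'-, g t <= b.
    by apply: filterS (near_left s sT) => t [st tT]; exact: Hg.
  exact: sF.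
have alip x s : x \in S -> 0 <= s -> s < T -> `|a x - u x s| <= K * (T - s).
  move=> xS s0 sT; apply: (@pass (fun t => `|u x t - u x s|) _ _ s) => //.
    by apply: cvg_norm; apply: cvgB; [exact: aP|exact: cvg_cst].
  by move=> t st tT; apply: le_trans (lip x s t xS s0 st tT) _; rewrite ler_wpM2l//; lra.
have ulim x : x \in S -> u x t @[t --> T^'-] --> a x.
  move=> xS; apply/cvgrPdist_le => e e0; near=> t.
  have [t0 tT] : 0 <= t /\ t < T by near: t; exact: near_left.
  apply: le_trans (alip x t xS t0 tT) _.
  have : T - e / (K + 1) <= t.
    by near: t; apply: nbhs_left_ge; rewrite ltrBlDr ltrDl divr_gt0// ltr_wpDl.
  rewrite lerBlDr addrC -lerBlDr ler_pdivlMr ?ltr_wpDl// => H.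
  by apply: le_trans H; rewrite mulrC ler_wpM2l ?lerDl// subr_ge0 ltW.
exists a => e e0.
have Glim : \forall t \near T^'-, forall x, `|G a x - G (u^~ t) x| <= e.
  apply: filter_forall => x; move: e e0; apply/cvgrPdist_le.
  exact: (cvg_vector_field w_weight p1 mu_ge0 sigma_ge0 mu_sigma_gt0 cf).
have [n /= n0 Hn] := Glim.
exists n => // x t xS t0 tn tT.
have -> : u x t - a x - G a x * (t - T) = - (a x - u x t - G a x * (T - t)) by ring.
rewrite normrN [`|t - T|]distrC (ger0_norm (_ : 0 <= T - t)); last by rewrite subr_ge0 ltW.
have slope s : t <= s -> s < T -> `|u x s - u x t - G a x * (s - t)| <= e * (s - t).
  move=> ts sT; apply: secant => // r /andP[tr rs]; rewrite distrC.
  by apply: Hn => /=; [rewrite ger0_norm; lra|lra].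
apply: (@pass (fun s => `|u x s - u x t - G a x * (s - t)|) _ _ t) => //.
  apply: cvg_norm; apply: cvgB; first by apply: cvgB; [exact: aP|exact: cvg_cst].
  apply: cvgM; first exact: cvg_cst.
  apply: cvgB; last exact: cvg_cst.
  have idT : s @[s --> T^'-] --> T by exact: cvg_within.
  by move=> A /idT; exact: sF.
by move=> s ts sT; apply: le_trans (slope s ts sT) _; rewrite ler_pM2l//; lra.
Unshelve. all: by end_near. Qed.

(** On [S] the solution is followed by a Peano solution that starts from its
    limit at [T]; the one-sided derivatives at [T] agree.  On the boundary the
    continuation is the p-mean of these values: up to [T] this is [u] by
    uniqueness of the p-mean, and it is differentiable in time throughout. *)
Lemma continuation : exists (T' : \bar R) (v : V -> R -> R),
  [/\ (T%:E < T')%E, is_solution E S w p mu sigma f u0 T' v &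
   forall x (t : R), x \in vclosure E S -> 0 <= t -> (t%:E < T%:E)%E -> v x t = u x t].
Proof.
have [a left_slope] := endpoint_slope.
have Gc := vector_field_continuous w_weight p1 mu_ge0 sigma_ge0 mu_sigma_gt0 cf.
have [del del0 [U [U0 Uslope]]] := peano a Gc.
pose vS x t := if t < T then u x t else U (t - T) x.
pose v x t := ext (vS^~ t) x.
have v_old x t : x \in vclosure E S -> 0 <= t -> t < T -> v x t = u x t.
  move=> xC t0 tT; have -> : v x t = ext (u^~ t) x.
    by rewrite /v; congr (ext _ x); apply/funext => y; rewrite /vS tT.
  have tT' : (t%:E < T%:E)%E by rewrite lte_fin.
  have bt := sol_satisfies_boundary sol t0 tT'.
  exact: (extend_id w_weight p1 mu_ge0 sigma_ge0 mu_sigma_gt0 bt xC).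
have v_in x : x \in S -> v x = vS x.
  by move=> xS; apply/funext => t; rewrite /v /ext extend_in.
have vS_new t : T <= t -> vS^~ t = U (t - T).
  by move=> Tt; apply/funext => y; rewrite /vS ltNge Tt.
have dvS x t : x \in S -> 0 < t -> t < T + del ->
    is_derive t (1 : R) (vS x) (G (vS^~ t) x).
  move=> xS t0 tT'; have [tT|Tt] := ltP t T.
    have -> : vS^~ t = u^~ t by apply/funext => y; rewrite /vS tT.
    apply: near_eq_is_derive (sol_vector_field xS t0 tT).
    near=> s; rewrite /vS ifT//; near: s; exact: lt_nbhsl.
  have tdel : 0 <= t - T <= del by apply/andP; split; lra.
  apply: is_derive_expansion => e e0.
  have [n n0 Hn] := Uslope (t - T) x e tdel e0.
  have [n' n'0 Hn'] := left_slope e e0.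
  (* Of all times from [T] on, only [T] has arbitrarily close times before [T]. *)
  have near_T : \forall s \near t, s < T -> t = T.
    move: Tt; rewrite le_eqVlt => /predU1P[<-|Tt]; first by near=> s.
    near=> s => sT; suff : T < s by move/(lt_trans sT); rewrite ltxx.
    by near: s; exact: lt_nbhsr.
  near=> s.
  have s0 : 0 < s by near: s; exact: lt_nbhsr.
  have sT' : s < T + del by near: s; exact: lt_nbhsl.
  have st : `|s - t| < Num.min n n'.
    rewrite distrC; near: s; apply: (nbhsx_ballx t (Num.min n n')).
    by rewrite lt_min n0.
  have [stn stn'] : `|s - t| < n /\ `|s - t| < n' by move: st; rewrite lt_min => /andP.
  rewrite (vS_new t Tt).
  have -> : vS x t = U (t - T) x by rewrite -(vS_new t Tt).
  have [sT|Ts] := ltP s T; last first.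
    have -> : vS x s = U (s - T) x by rewrite -(vS_new s Ts).
    have -> : s - t = (s - T) - (t - T) by ring.
    apply: Hn; first by apply/andP; split; lra.
    by have -> : (s - T) - (t - T) = s - t by ring.
  have tE : t = T by move: sT; near: s; exact: near_T.
  rewrite tE subrr U0 /vS sT; apply: Hn' => //; first exact: ltW.
  move: stn'; rewrite tE distrC ltr_norml => /andP[_]; lra.
have dv x t : x \in vclosure E S -> 0 < t -> t < T + del -> derivable (v x) t 1.
  move=> xC t0 tT'; apply: (derivable_extend w_weight) => // y yS.
  by have [] := dvS y t yS t0 tT'.
exists (T + del)%:E, v; split.
- by rewrite lte_fin ltrDl.
- split.
  + by rewrite lte_fin addr_gt0.
  + move=> x xC; apply/within_continuousP => t [t0]; rewrite lte_fin => tT'.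
    move: t0; rewrite le_eqVlt => /predU1P[t0|t0]; last first.
      have : {for t, continuous (v x)}.
        by apply/differentiable_continuous/derivable1_diffP/dv.
      by apply: cvg_trans; apply: cvg_app; exact: cvg_within.
    subst t; rewrite v_old//.
    have /cvgrPdist_le u_cvg := sol_cvg sol xC (conj (lexx 0) (sol_time_gt0 sol)).
    apply/cvgrPdist_le => e e0; have := u_cvg e e0; rewrite !near_withinE => H.
    near=> s => -[s0 _]; have sT : s < T by near: s; exact: lt_nbhsl.
    rewrite v_old//; have : lifespan T%:E s -> `|u x 0 - u x s| <= e by near: s; exact: H.
    by apply; split => //; rewrite lte_fin.
  + by move=> x t xC t0; rewrite lte_fin => tT'; exact: dv.
  + move=> x t xS t0; rewrite lte_fin => tT'.
    rewrite v_in// derive1E; have [_ ->] := dvS x t xS t0 tT'.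
    by rewrite /G /vector_field xS.
  + move=> z t zB t0 _.
    have := @extend_boundary _ _ E S w mu sigma p w_weight p1 mu_ge0 sigma_ge0 (vS^~ t).
    by apply.
  + by move=> x xC; rewrite v_old// (sol_initial sol).
- by move=> x t xC t0; rewrite lte_fin => tT; exact: v_old.
Unshelve. all: by end_near. Qed.

End Continuation.

(** * Blow-up *)

Theorem theorem3p3 (R : realType) (V : finType) (E : rel V) (S : {set V})
    (w : V -> V -> R) (mu sigma : V -> R) (p lambda alpha beta gamma : R)
    (f : R -> R) (u0 : V -> R) (T : \bar R) (u : V -> R -> R)
    (E_sym : symmetric E) (E_irr : irreflexive E)
    (S_conn : connected_in E S) (w_weight : is_weight E w)
    (mu_ge0 : forall z, z \in vboundary E S -> 0 <= mu z)
    (sigma_ge0 : forall z, z \in vboundary E S -> 0 <= sigma z)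
    (mu_sigma_gt0 : forall z, z \in vboundary E S -> 0 < mu z + sigma z)
    (p_gt1 : 1 < p)
    (lambda_first : is_first_eigenvalue E S w p mu sigma lambda)
    (f_loclip : [locally [lipschitz f s | s in setT]])
    (f0 : f 0 = 0) (f_gt0 : forall s, 0 < s -> 0 < f s)
    (alpha_gt2 : 2 < alpha) (gamma_gt0 : 0 < gamma)
    (beta_bounds : 0 <= beta <= (alpha - p) * lambda / p)
    (f_growth : forall s, 0 < s ->
      alpha * primitive0 f s <= s * f s + beta * s `^ p + gamma)
    (u0_ge0 : forall x, x \in vclosure E S -> 0 <= u0 x)
    (u0_nontrivial : exists2 x, x \in vclosure E S & u0 x != 0)
    (u0_boundary : forall z, z \in vboundary E S ->
      boundary_op S w p mu sigma u0 z = 0)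
    (u0_energy :
      0 < - (1 / (2 * p)) *
            (\sum_(x in vclosure E S) \sum_(y in vclosure E S)
               `|u0 x - u0 y| `^ p * w x y)
          - 1 / p *
            (\sum_(z in Gamma_set E S mu) sigma z / mu z * `|u0 z| `^ p)
          + \sum_(x in S) (primitive0 f (u0 x) - gamma))
    (u_max : is_maximal_solution E S w p mu sigma f u0 T u) :
  exists Tstar : R,
    [/\ 0 < Tstar, T = Tstar%:E
      & (\sum_(x in S) u x t ^+ 2) @[t --> Tstar^'-] --> +oo].
Proof.
have [sol maximal] := u_max.
have [Y [dY [c [e [K [[c0 e0 cY dYE Y0] [ineq Ymass uY]]]]]]] :=
  growth_functional w_weight p_gt1 mu_ge0 sigma_ge0 mu_sigma_gt0 f_loclip f0 u0_ge0
    sol lambda_first f_gt0 alpha_gt2 gamma_gt0 beta_bounds f_growth u0_energy.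
have T0 := sol_time_gt0 sol.
have dY0 t : 0 < t -> (t%:E < T)%E -> 0 <= dY t.
  by move=> t0 tT; apply: le_trans (ineq t t0 tT); rewrite mulr_ge0 ?powR_ge0// ltW.
have [B HB] := superlinear_finite_time c0 e0 T0 cY dYE Y0 ineq.
have [Ts TE] : exists Ts : R, T = Ts%:E.
  case: T T0 HB {cY dYE Y0 ineq Ymass uY dY0 sol maximal u_max} => [r _ _|_ HB|//].
    by exists r.
  have : `|B| + 1 <= B by apply: HB; split => //=; rewrite ?addr_ge0// ltry.
  by have := ler_norm B; lra.
exists Ts; subst T.
have Ts0 : 0 < Ts by rewrite lte_fin in T0.
split => //.
have unbounded A : exists t, [/\ 0 <= t, t < Ts & A < Y t].
  apply: contrapT => H.
  have [|T' [v [TT' sol' agree]]] := @continuation R V E S w mu sigma p f u0 Ts u w_weight p_gt1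
    mu_ge0 sigma_ge0 mu_sigma_gt0 f_loclip sol (A + 1).
    move=> x t xS t0 tT; have tl : lifespan Ts%:E t by split => //; rewrite lte_fin.
    apply: le_trans (uY t x tl xS) _; rewrite lerD2r leNgt; apply/negP => AY.
    by apply: H; exists t.
  exact: (maximal T' v TT' sol' agree).
apply/cvgryPge => A.
have [s [s0 sT AY]] := unbounded (A + K).
near=> t.
have st : s <= t by near: t; exact: nbhs_left_ge.
have tT : t < Ts by near: t; exact: nbhs_left_lt.
have tl : lifespan Ts%:E t by split; [exact: le_trans st|rewrite lte_fin].
rewrite -(lerD2r K); apply: le_trans (ltW AY) _; apply: le_trans (Ymass t tl).
by apply: (ndecr_lifespan cY dYE dY0) => //; rewrite lte_fin.
Unshelve. all: by end_near. Qed.
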